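(* Let $\mathcal{CW}$ be the class of planar convex bodies of constant width $1$. Finding the shape in $\mathcal{CW}$ with minimal area is equivalent to solving the problem \[ \max\Big\{ \tfrac12 \operatorname{Per}(S)-A(S)\ :\ S=\operatorname{conv}\{K,-K\},\ K\in\mathcal{CW}\Big\}. \] That is, $K_0\in\mathcal{CW}$ minimizes $A(K)$ among all $K\in\mathcal{CW}$ if and only if $S_0=\operatorname{conv}\{K_0,-K_0\}$ maximizes $\tfrac12\operatorname{Per}(S)-A(S)$ among all sets $S$ of the form $S=\operatorname{conv}\{K,-K\}$ with $K\in\mathcal{CW}$.
   Context: A planar convex body has constant width $1$ if the distance between any two distinct parallel supporting lines is $1$. $A(\cdot)$ denotes area and $\operatorname{Per}(\cdot)$ denotes perimeter in the plane; $-K=\{-x:x\in K\}$ and $\operatorname{conv}\{K,-K\}$ is the convex hull of $K\cup(-K)$. *)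

(* Defs.v *)
From HB Require Import structures.
From mathcomp Require Import all_boot all_order all_algebra.
From mathcomp Require Import all_classical all_reals all_analysis.

Set Implicit Arguments.
Unset Strict Implicit.
Unset Printing Implicit Defensive.

Import Order.TTheory GRing.Theory Num.Theory.
Import numFieldNormedType.Exports.

Local Open Scope classical_set_scope.
Local Open Scope ring_scope.

(* The plane is R * R with its product topology and product sigma-algebra.
   The library norm on R * R is the sup norm, hence the explicit Euclidean
   norm below. *)
Section Plane.
Context {R : realType}.
Local Notation plane := (R * R)%type.
Implicit Types (u v x y : plane) (c d w : R) (A B K S : set plane).

Definition dot u v : R := u.1 * v.1 + u.2 * v.2.

Definition enorm u : R := Num.sqrt (dot u u).

Definition det2 u v : R := u.1 * v.2 - u.2 * v.1.

(* The interior is required to be nonempty: a singleton has no two distinct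
   parallel supporting lines, so it would vacuously have every constant
   width. *)
Definition convex_body K : Prop :=
  [/\ compact K, convex_set K & K° !=set0].

Definition line u c : set plane := [set x | dot u x = c].

Definition supporting_line K u c : Prop :=
  (line u c `&` K !=set0) /\
  (K `<=` [set x | dot u x <= c] \/ K `<=` [set x | c <= dot u x]).

Definition set_dist A B : R := inf [set enorm (x - y) | x in A & y in B].

(* Parallel lines are exactly those that can be written with a common
   normal vector u. *)
Definition constant_width K w : Prop :=
  forall u c d, u != 0 ->
    supporting_line K u c -> supporting_line K u d ->
    line u c <> line u d ->
    set_dist (line u c) (line u d) = w.

Definition CW : set (set plane) :=
  [set K | convex_body K /\ constant_width K 1].

Definition area A : \bar R :=
  (@lebesgue_measure R \x @lebesgue_measure R)%E A.

Definition boundary A : set plane := closure A `\` A°.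

(* Vertices of a strictly convex polygon, listed counterclockwise.  The
   condition is empty for n <= 2, so points and doubly covered segments are
   admitted as degenerate polygons; they do not affect the supremum below when
   S is a convex body. *)
Definition convex_polygon n (p : 'I_n -> plane) : Prop :=
  forall i j k : 'I_n, (i < j < k)%N -> 0 < det2 (p j - p i) (p k - p i).

Definition polygon_length n (p : 'I_n -> plane) : R :=
  \sum_(i < n) enorm (p (ordS i) - p i).

(* Length of the boundary curve of a convex set: the supremum of the lengths of
   the polygons inscribed in it.  Restricting to vertices in strictly convex
   position makes consecutive vertices consecutive along the boundary, and
   loses nothing, since dropping a vertex that lies on the segment between its
   neighbours does not change the length. *)
Definition perimeter S : \bar R :=
  ereal_sup [set l | exists n (p : 'I_n -> plane),
    [/\ convex_polygon p, forall i, boundary S (p i)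
      & l = (polygon_length p)%:E]].

Definition conv_hull A : set plane := smallest (@convex_set R plane) A.

Definition symm_hull K : set plane := conv_hull (K `|` [set - x | x in K]).

Definition objective S : \bar R :=
  ((2^-1)%:E * perimeter S - area S)%E.

End Plane.

Definition minimizes {R : realType} {T : Type} (F : T -> \bar R) (C : set T)
    (x : T) : Prop :=
  C x /\ forall y, C y -> (F x <= F y)%E.

Definition maximizes {R : realType} {T : Type} (F : T -> \bar R) (C : set T)
    (x : T) : Prop :=
  C x /\ forall y, C y -> (F y <= F x)%E.

(* Main.v *)
Require Import Defs.
From mathcomp Require Import all_boot all_order all_algebra.
From mathcomp Require Import all_classical all_reals all_analysis.
From mathcomp Require Import ring lra zify.

(* Let [h] be the support function of [K].  Constant width says that
   [h = 1/2 + g] with [g (- u) = - g u], and then the support function of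
   [S = conv (K, -K)] is [1/2 + |g|].  The area is the quadratic functional
   [1/2 int (h^2 - h'^2)] and the perimeter is [int h], and the quadratic parts
   coming from [g] and [|g|] agree, so that [2 A(K) - 2 A(S) + Per S] does not
   depend on [K] (its value is pi).

   To avoid differentiating [h], only the [2 m] unit vectors [u_k] at multiples
   of the angle [pi / m] are used, with error terms that vanish as [m] grows.
   - Area: the polygon circumscribed along the directions [u_k] and the one
     inscribed at the contact points are compared with the set through vertical
     trapezoids lying between their edges and a fixed horizontal line.
   - Perimeter: the length of a segment is, up to a factor tending to 1, a
     multiple of the sum of its projections on the [u_k], and the projections
     of a closed convex polygon add up to twice its width.
   - The discrete quadratic forms of [g] and [|g|] differ only at the sign
     changes of [g]; as [K] and [- K] both have nonnegative curvature radii, [g]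
     has bounded second differences, which makes this contribution negligible. *)

Set Implicit Arguments.
Unset Strict Implicit.
Unset Printing Implicit Defensive.

Import Order.TTheory GRing.Theory Num.Theory.
Import numFieldNormedType.Exports.

Local Open Scope classical_set_scope.
Local Open Scope ring_scope.

(** * Plane vectors and equally spaced directions *)

(** The sign changes are the real obstacle. Neighbouring values of [g] differ by [O(1/m)], so a sign
    change costs [O(1/m^2)] in the quadratic form. If all [2 m] steps changed sign, these costs,
    divided by [sin (pi / m)] as in the area formula, would stay of order 1. Second differences of
    order [1/m^2] gain the missing power of [1/m]. The constant pi is never computed: two bodies are
    compared at the same [m], and the common main term [2 m tan (pi / (2 m))] cancels before any
    limit is taken. *)

Lemma sum_shift (V : nmodType) (F : nat -> V) (N a : nat) :
  (forall k, F (k + N)%N = F k) ->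
  \sum_(i < N) F (i + a)%N = \sum_(i < N) F i.
Proof.
move=> FN; elim: a => [|a <-]; first by apply: eq_bigr => i _; rewrite addn0.
case: N FN => [|N] FN; first by rewrite !big_ord0.
rewrite big_ord_recr /= [RHS]big_ord_recl /= addrC; congr (_ + _).
  by rewrite addnS -addSn addnC FN add0n.
by apply: eq_bigr => i _; rewrite /bump /= add1n addSn addnS.
Qed.

Lemma pairZ (R : realType) (a : R) (x : R * R) : a *: x = (a * x.1, a * x.2).
Proof. by []. Qed.

Section Directions.
Context {R : realType}.
Local Notation plane := (R * R)%type.
Variable m : nat.
Hypothesis m_ge2 : (2 <= m)%N.

Definition perp (u : plane) : plane := (- u.2, u.1).

Definition dir (k : nat) : plane :=
  (cos (k%:R * (pi / m%:R)), sin (k%:R * (pi / m%:R))).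

(** Half of the step angle is used because the rotation by one step is then polynomial in [hsin m]
    and [hcos m]; [hsin m] is the small parameter of all the estimates. *)
Definition hsin : R := sin (pi / (2 * m%:R)).
Definition hcos : R := cos (pi / (2 * m%:R)).

Let m_gt0 : 0 < m%:R :> R. Proof. by rewrite ltr0n; lia. Qed.

Lemma hsin_gt0 : 0 < hsin.
Proof.
apply: sin_gt0_pihalf; rewrite divr_gt0 ?pi_gt0 ?mulr_gt0//=.
rewrite invfM mulrA ltr_pdivrMr// ltr_pMr ?divr_gt0 ?pi_gt0//.
by rewrite ltr1n.
Qed.

Lemma hcos_gt0 : 0 < hcos.
Proof.
have pm : 0 < pi / (2 * m%:R) :> R by rewrite divr_gt0 ?pi_gt0 ?mulr_gt0.
apply: cos_gt0_pihalf; apply/andP; split.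
  by apply: lt_trans pm; rewrite oppr_lt0 divr_gt0// pi_gt0.
rewrite invfM mulrA ltr_pdivrMr// ltr_pMr ?divr_gt0 ?pi_gt0//.
by rewrite ltr1n.
Qed.

Lemma hcos2Dhsin2 : hcos ^+ 2 + hsin ^+ 2 = 1.
Proof. exact: cos2Dsin2. Qed.

Lemma cos_step : cos (pi / m%:R) = 1 - 2 * hsin ^+ 2 :> R.
Proof.
have -> : pi / m%:R = (pi / (2 * m%:R)) *+ 2 :> R.
  by rewrite -mulr_natr invfM; field; rewrite gt_eqF.
by rewrite cos_mulr2n -/hcos -/hsin -mulr_natr; have := hcos2Dhsin2; nra.
Qed.

Lemma sin_step : sin (pi / m%:R) = 2 * hsin * hcos :> R.
Proof.
have -> : pi / m%:R = (pi / (2 * m%:R)) *+ 2 :> R.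
  by rewrite -mulr_natr invfM; field; rewrite gt_eqF.
by rewrite sin_mulr2n -/hcos -/hsin -mulr_natr; ring.
Qed.

Lemma dirS k : dir k.+1 =
  (1 - 2 * hsin ^+ 2) *: dir k + (2 * hsin * hcos) *: perp (dir k).
Proof.
rewrite -cos_step -sin_step /dir /perp -[k.+1]addn1 natrD mulrDl mul1r cosD sinD.
by rewrite !pairZ; congr pair => /=; ring.
Qed.

Lemma dir_norm k : (dir k).1 ^+ 2 + (dir k).2 ^+ 2 = 1.
Proof. exact: cos2Dsin2. Qed.

Lemma dot_dir_dir k : dot (dir k) (dir k) = 1.
Proof. by rewrite /dot -!expr2 dir_norm. Qed.

Lemma dirDm k : dir (k + m) = - dir k.
Proof.
have mpi : m%:R * (pi / m%:R) = pi :> R by rewrite mulrCA divff ?gt_eqF ?mulr1.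
rewrite /dir natrD mulrDl mpi.
by rewrite sinDpi cosDpi.
Qed.

Lemma dirD2m k : dir (k + m.*2) = dir k.
Proof. by rewrite -addnn addnA !dirDm opprK. Qed.

Lemma dir0 : dir 0 = (1, 0).
Proof. by rewrite /dir mul0r cos0 sin0. Qed.

Lemma sin_dir_gt0 k : (0 < k < m)%N -> 0 < (dir k).2.
Proof.
move=> /andP[k0 km] /=; apply: sin_gt0_pi; apply/andP; split.
  by apply: mulr_gt0; rewrite ?ltr0n// divr_gt0// pi_gt0.
by rewrite mulrCA gtr_pMr ?pi_gt0// ltr_pdivrMr// mul1r ltr_nat.
Qed.

Lemma sin_dir_ge0 k : (k <= m)%N -> 0 <= (dir k).2.
Proof.
move=> km; case: (posnP k) => [->|k0]; first by rewrite dir0.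
case: (ltngtP k m) km => // [km|->] _.
  by rewrite ltW// sin_dir_gt0// k0 km.
by rewrite -[m]add0n dirDm dir0/= oppr0.
Qed.

Lemma dirD j i : dir (j + i) = (dir i).1 *: dir j + (dir i).2 *: perp (dir j).
Proof.
rewrite /dir /perp natrD mulrDl cosD sinD.
by rewrite !pairZ; congr pair => /=; ring.
Qed.

End Directions.

Section DotLemmas.
Context {R : realType}.
Local Notation plane := (R * R)%type.
Implicit Types (x y u v : plane).

Lemma dotC x y : dot x y = dot y x.
Proof. by rewrite /dot; ring. Qed.

Lemma dotDl x y u : dot (x + y) u = dot x u + dot y u.
Proof. by rewrite /dot /=; ring. Qed.

Lemma dotDr u x y : dot u (x + y) = dot u x + dot u y.
Proof. by rewrite /dot /=; ring. Qed.

Lemma dotNl x u : dot (- x) u = - dot x u.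
Proof. by rewrite /dot /=; ring. Qed.

Lemma dotNr x u : dot x (- u) = - dot x u.
Proof. by rewrite /dot /=; ring. Qed.

Lemma dotBl x y u : dot (x - y) u = dot x u - dot y u.
Proof. by rewrite dotDl dotNl. Qed.

Lemma dotZl (a : R) x u : dot (a *: x) u = a * dot x u.
Proof. by rewrite !pairZ /dot /=; ring. Qed.

Lemma dotZr (a : R) x u : dot x (a *: u) = a * dot x u.
Proof. by rewrite !pairZ /dot /=; ring. Qed.

Lemma dot_ge0 x : 0 <= dot x x.
Proof. by rewrite /dot -!expr2 addr_ge0// sqr_ge0. Qed.

Lemma enorm_ge0 x : 0 <= enorm x.
Proof. exact: sqrtr_ge0. Qed.

Lemma enorm_sqr x : enorm x ^+ 2 = dot x x.
Proof. by rewrite sqr_sqrtr// dot_ge0. Qed.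

Lemma dot_le_enorm x u : dot u u = 1 -> `|dot x u| <= enorm x.
Proof.
move=> u1; rewrite -[leLHS]ger0_norm ?normr_ge0// -ler_sqr ?nnegrE ?enorm_ge0//.
rewrite normr_id real_normK ?num_real// enorm_sqr.
rewrite -[leRHS]mulr1 -u1 -subr_ge0.
have -> : dot x x * dot u u - dot x u ^+ 2 = det2 x u ^+ 2.
  by rewrite /dot /det2; ring.
exact: sqr_ge0.
Qed.

Lemma det2_dot x y v :
  dot x v *: y - dot y v *: x = det2 x y *: perp v.
Proof.
by rewrite !pairZ /dot /det2 /perp; congr pair => /=; ring.
Qed.

End DotLemmas.

(** * Lengths from projections *)

Section ProjectionLength.
Context {R : realType}.
Local Notation plane := (R * R)%type.
Variable m : nat.
Hypothesis m_ge2 : (2 <= m)%N.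

Lemma discrete_ivt (f : nat -> R) a n :
  f a <= 0 -> 0 <= f (a + n.+1)%N -> exists j, f j <= 0 /\ 0 <= f j.+1.
Proof.
elim: n => [|n IH] fa fan; first by exists a; rewrite addn1 in fan.
have [fn|fn] := leP 0 (f (a + n.+1)%N); first exact: IH.
by exists (a + n.+1)%N; rewrite -addnS ltW.
Qed.

(* The witness [v] bisects the two consecutive directions between which
   [dot e] changes sign; on the half turn starting there all the projections
   are nonnegative and their sum telescopes. *)
Lemma sum_dot_dir (e : plane) : exists v : plane,
  [/\ dot v v = 1,
      hsin m * (\sum_(k < m) `|dot e (dir m k)|) = dot e (perp v),
      0 <= dot e (perp v) &
      hcos m * `|dot e v| <= hsin m * dot e (perp v)].
Proof.
pose q : R := hsin m; pose r : R := hcos m.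
have q0 : 0 < q := hsin_gt0 m_ge2; have r0 : 0 < r := hcos_gt0 m_ge2.
have qr : r ^+ 2 + q ^+ 2 = 1 := hcos2Dhsin2 m.
have r2 : r ^+ 2 = 1 - q ^+ 2 by rewrite -qr addrK.
pose f k := dot e (dir m k).
have fm k : f (k + m)%N = - f k by rewrite /f dirDm// dotNr.
have [j [fj fj1]] : exists j, f j <= 0 /\ 0 <= f j.+1.
  have m1 : m = m.-1.+1 by lia.
  have [f0|f0] := leP (f 0%N) 0.
    apply: (@discrete_ivt f 0 m.-1) => //.
    by rewrite -m1 fm oppr_ge0.
  apply: (@discrete_ivt f (0 + m) m.-1); first by rewrite fm oppr_le0 ltW.
  by rewrite -m1 !fm opprK ltW.
have fE k : f k.+1 = (1 - 2 * q ^+ 2) * f k + (2 * q * r) * dot e (perp (dir m k)).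
  by rewrite /f dirS// dotDr !dotZr.
have fge0 i : (i < m)%N -> 0 <= f (i + j.+1)%N.
  (* [f] samples a sinusoid, so it is determined by its values at [j] and [j.+1], with sines of
     multiples of the step as weights; [q * r] is half the sine of one step. *)
  move=> im; rewrite -(pmulr_rge0 _ (mulr_gt0 q0 r0)).
  have -> : q * r * f (i + j.+1)%N =
      2^-1 * ((dir m i.+1).2 * f j.+1 - (dir m i).2 * f j).
    rewrite fE /f [(i + _)%N]addnC dirD !dirS// -/q -/r.
    move: (dir m j) (dir m i) => A B; rewrite /dot /perp !pairZ /=.
    by field: r2.
  rewrite mulr_ge0 ?invr_ge0// subr_ge0.
  apply: (@le_trans _ _ 0); first by rewrite mulr_ge0_le0// sin_dir_ge0// ltnW.
  by rewrite mulr_ge0// sin_dir_ge0.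
pose w k : plane := r *: dir m k + q *: perp (dir m k).
have wm k : w (k + m)%N = - w k.
  by rewrite /w dirDm// /perp !pairZ /=; congr pair => /=; ring.
have ww k : dot (w k) (w k) = 1.
  rewrite /w; move: (dir m k) (dir_norm (R := R) m k) => A A1.
  by rewrite -qr -[RHS]mulr1 -A1 /perp /dot !pairZ /=; ring.
have e1 : f j = r * dot e (w j) - q * dot e (perp (w j)).
  rewrite /w /f; move: (dir m j) => A.
  by rewrite /dot /perp !pairZ /=; ring: r2.
have e2 : f j.+1 = r * dot e (w j) + q * dot e (perp (w j)).
  rewrite fE /w /f; move: (dir m j) => A.
  by rewrite /dot /perp !pairZ /=; ring: r2.
exists (w j); split; first exact: ww.
- have sumE n : 2 * q * \sum_(i < n) f (i + j.+1)%N =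
      dot e (perp (w j)) - dot e (perp (w (j + n)%N)).
    elim: n => [|n IH]; first by rewrite big_ord0 addn0 mulr0 subrr.
    rewrite big_ord_recr /= mulrDr IH -addSnnS addSn [(n + j)%N]addnC addnS.
    rewrite /w dirS// -/q -/r /f dirS// -/q -/r.
    move: (dir m (j + n)%N) => A; rewrite /dot /perp !pairZ /=.
    ring: r2.
  have -> : \sum_(k < m) `|dot e (dir m k)| = \sum_(i < m) f (i + j.+1)%N.
    rewrite -(@sum_shift _ (fun k => `|f k|) m j.+1); last first.
      by move=> k; rewrite fm normrN.
    by apply: eq_bigr => i _; rewrite ger0_norm// fge0.
  have := sumE m; rewrite wm.
  have -> : perp (- w j) = - perp (w j) by rewrite /perp; congr pair.
  by rewrite dotNr -/q; lra.
- by move: fj fj1; rewrite e1 e2 => h1 h2; rewrite -(pmulr_rge0 _ q0); lra.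
- move: fj fj1; rewrite e1 e2 => h1 h2.
  have -> : hcos m * `|dot e (w j)| = `|r * dot e (w j)|.
    by rewrite normrM (gtr0_norm r0).
  by rewrite ler_norml -/q; apply/andP; split; lra.
Qed.

Lemma sum_dot_dir_le (e : plane) :
  hsin m * (\sum_(k < m) `|dot e (dir m k)|) <= enorm e.
Proof.
have [v [v1 -> v0 _]] := sum_dot_dir e.
rewrite -[leLHS]ger0_norm//; apply: dot_le_enorm.
by rewrite -v1 /dot /perp/=; ring.
Qed.

(** The bound on [dot e v] says that [e] makes an angle of at most [pi / (2 m)] with [perp v], so
    its projection on [perp v] keeps the fraction [hcos m] of its length. *)
Lemma sum_dot_dir_ge (e : plane) :
  enorm e * hcos m <= hsin m * (\sum_(k < m) `|dot e (dir m k)|).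
Proof.
have [v [v1 -> Y0]] := sum_dot_dir e.
have q0 : 0 < hsin m :> R := hsin_gt0 m_ge2.
have r0 : 0 < hcos m :> R := hcos_gt0 m_ge2.
have qr := hcos2Dhsin2 (R := R) m.
move: (hcos m) (hsin m) q0 r0 qr => r q q0 r0 qr le1.
have le2 : (r * `|dot e v|) ^+ 2 <= (q * dot e (perp v)) ^+ 2.
  by rewrite ler_sqr// nnegrE mulr_ge0// ltW.
have er0 : 0 <= enorm e * r by rewrite mulr_ge0 ?enorm_ge0 ?(ltW r0).
rewrite -ler_sqr ?nnegrE// exprMn enorm_sqr.
have -> : dot e e = dot e v ^+ 2 + dot e (perp v) ^+ 2.
  by rewrite -[LHS]mulr1 -v1; rewrite /dot /perp /=; ring.
have q2 : q ^+ 2 = 1 - r ^+ 2 by rewrite -qr [_ + q ^+ 2]addrC addrK.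
move: le2; rewrite !exprMn real_normK ?num_real// q2.
by nra.
Qed.

End ProjectionLength.

(** * Closed polygons and total variation *)

Section TotalVariation.
Context {R : realType}.
Implicit Types F : nat -> R.

Definition cyclic_tv F n : R := \sum_(i < n) `|F i.+1 - F i|.

Lemma cyclic_tv_shift F n a : (forall k, F (k + n)%N = F k) ->
  cyclic_tv (fun k => F (a + k)%N) n = cyclic_tv F n.
Proof.
move=> Fn; rewrite /cyclic_tv.
rewrite -(@sum_shift _ (fun k => `|F k.+1 - F k|) n a); last first.
  by move=> k; rewrite -addSn !Fn.
by apply: eq_bigr => i _; rewrite addnS [(i + a)%N]addnC.
Qed.

Lemma tvD F a b : cyclic_tv F (a + b) =
  cyclic_tv F a + cyclic_tv (fun k => F (a + k)%N) b.
Proof.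
rewrite /cyclic_tv big_split_ord /=; congr (_ + _).
by apply: eq_bigr => i _; rewrite addnS.
Qed.

Lemma tv_ge F n : `|F n - F 0%N| <= cyclic_tv F n.
Proof.
rewrite /cyclic_tv; elim: n => [|n IH]; first by rewrite subrr normr0 big_ord0.
rewrite big_ord_recr /=; have -> : F n.+1 - F 0%N = (F n - F 0%N) + (F n.+1 - F n).
  by ring.
by apply: le_trans (ler_normD _ _) _; rewrite lerD2r.
Qed.

(** Cutting the closed walk at [a] and [b] leaves two arcs, and each varies by at least the
    difference of its end values. *)
Lemma cyclic_tv_ge F n a b : (forall k, F (k + n)%N = F k) ->
  (a < n)%N -> (b < n)%N -> 2 * (F a - F b) <= cyclic_tv F n.
Proof.
move=> Fn; suff h : forall a b, (a <= b < n)%N ->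
    2 * `|F a - F b| <= cyclic_tv F n.
  move=> an bn; have [ab|ba] := leqP a b.
    apply: le_trans (h a b _); last by rewrite ab.
    by rewrite ler_pM2l// ler_norm.
  apply: le_trans (h b a _); last by rewrite ltnW.
  by rewrite ler_pM2l// distrC ler_norm.
move=> {}a {}b /andP[ab bn]; rewrite -(cyclic_tv_shift a Fn).
have -> : n = ((b - a) + (n - (b - a)))%N by lia.
rewrite tvD mulrDl mul1r; apply: lerD.
  by apply: le_trans (tv_ge _ _); rewrite addn0 subnKC// distrC.
apply: le_trans (tv_ge _ _); rewrite addn0 (subnKC ab).
have -> : (a + (b - a + (n - (b - a))))%N = (a + n)%N by lia.
by rewrite Fn.
Qed.

Lemma tv_nondecreasing F n : (forall i, (i < n)%N -> F i <= F i.+1) ->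
  cyclic_tv F n = F n - F 0%N.
Proof.
rewrite /cyclic_tv; elim: n => [|n IH] h; first by rewrite big_ord0 subrr.
rewrite big_ord_recr /= IH => [|i im]; last by apply: h; rewrite ltnW.
by rewrite ger0_norm ?subr_ge0 ?h//; ring.
Qed.

Lemma tv_nonincreasing F n : (forall i, (i < n)%N -> F i.+1 <= F i) ->
  cyclic_tv F n = F 0%N - F n.
Proof.
move=> h; have := @tv_nondecreasing (fun k => - F k) n.
rewrite opprK addrC => <-; last by move=> i im; rewrite lerN2 h.
by apply: eq_bigr => i _; rewrite -opprB normrN opprK addrC.
Qed.

(* The diagonals [a c] and [b d] are separated by the functional [F]. *)
Definition crossing F a b c d :=
  (F a < F b /\ F a < F d) /\ (F c < F b /\ F c < F d) \/
  (F b < F a /\ F d < F a) /\ (F b < F c /\ F d < F c).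

(* If no crossing occurs, [F] increases from its minimum to its maximum and
   decreases on the way back. *)
Lemma unimodal_tv F n W : (0 < n)%N -> (forall k, F (k + n)%N = F k) ->
  (forall a b c d, (a < b < c)%N -> (c < d < n)%N -> ~ crossing F a b c d) ->
  (forall a b, F a - F b <= W) ->
  cyclic_tv F n <= 2 * W.
Proof.
move=> n0 Fn hx hW.
have FnB k : (n <= k)%N -> F k = F (k - n)%N.
  by move=> nk; rewrite -[in LHS](subnK nk) Fn.
have crossC a b c d : crossing F a b c d -> crossing F b c d a.
  by rewrite /crossing; tauto.
(* The hypothesis covers indices below [n]; it is carried to every window of length [n]. Reduction
   modulo [n] rotates the four indices, and a crossing survives rotation. *)
have hx' a b c d : (a < b < c)%N -> (c < d < a + n)%N -> ~ crossing F a b c d.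
  have [q] := ubnP a; elim: q a b c d => // q IH a b c d aq abc cda.
  have [an|na] := leqP n a; last first.
    have [dn|nd] := ltnP d n; first by apply: hx => //; lia.
    have [cn|nc] := ltnP c n.
      move=> /crossC /crossC /crossC; rewrite /crossing (FnB d)//.
      by apply: hx; lia.
    have [bn|nb] := ltnP b n.
      move=> /crossC /crossC; rewrite /crossing (FnB d)// (FnB c)//.
      by apply: hx; lia.
    move=> /crossC; rewrite /crossing (FnB d) 1?(FnB c) ?(FnB b); try lia.
    by apply: hx; lia.
  rewrite /crossing (FnB d) 1?(FnB c) ?(FnB b) ?(FnB a); try lia.
  by apply: (IH (a - n) (b - n) (c - n) (d - n))%N; lia.
have Fmod k : F k = F (k %% n)%N.
  rewrite {1}(divn_eq k n); elim: (k %/ n)%N => [|p IH] //.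
  by rewrite mulSn -addnA addnC Fn.
have [i0 _ hmin] := @arg_minP _ _ 'I_n (Ordinal n0) xpredT (fun i => F i) isT.
have [i1 _ hmax] := @arg_maxP _ _ 'I_n (Ordinal n0) xpredT (fun i => F i) isT.
have Fmin k : F i0 <= F k.
  by rewrite (Fmod k); exact: (hmin (Ordinal (ltn_pmod k n0))).
have Fmax k : F k <= F i1.
  by rewrite (Fmod k); exact: (hmax (Ordinal (ltn_pmod k n0))).
have [M [i0M Mi0 FM]] : exists M, [/\ (i0 <= M)%N, (M < i0 + n)%N & F M = F i1].
  have := ltn_ord i0; have := ltn_ord i1; have [le01|lt10] := leqP i0 i1 => l1 l0.
    by exists i1; split => //; lia.
  by exists (i1 + n)%N; split; [lia|lia|rewrite Fn].
rewrite -(cyclic_tv_shift i0 Fn).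
have nE : n = ((M - i0) + (n - (M - i0)))%N by lia.
rewrite [X in cyclic_tv _ X]nE tvD tv_nondecreasing; last first.
  move=> i iM; rewrite leNgt; apply/negP => lt.
  (* A descent on the way from the minimum [i0] to the maximum [M] gives four indices whose values
     alternate low, high, low, high. *)
  apply: (@hx' i0 (i0 + i)%N (i0 + i.+1)%N M).
  - case: i iM lt => [|i] iM lt; last lia.
    by exfalso; have := Fmin (i0 + 1)%N; rewrite leNgt => /negP; apply;
      rewrite addn0 in lt.
  - apply/andP; split; last by [].
    rewrite ltn_neqAle; apply/andP; split; last lia.
    apply/eqP => e; move: lt; rewrite e FM => lt.
    by have := Fmax (i0 + i)%N; rewrite leNgt lt.
  - left; rewrite FM; split; split.
    + exact: le_lt_trans (Fmin _) lt.
    + by apply: lt_le_trans (Fmax (i0 + i)%N); exact: le_lt_trans (Fmin _) lt.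
    + exact: lt.
    + exact: lt_le_trans lt (Fmax _).
rewrite tv_nonincreasing; last first.
  move=> i iM; rewrite leNgt; apply/negP => lt.
  have eM : (i0 + (M - i0 + i))%N = (M + i)%N by lia.
  have eM1 : (i0 + (M - i0 + i.+1))%N = (M + i).+1 by lia.
  rewrite eM eM1 in lt.
  apply: (@hx' i0 M (M + i)%N (M + i).+1).
  - apply/andP; split; last first.
      case: i iM lt {eM eM1} => [|i] iM lt; last lia.
      by move: lt; rewrite addn0 => lt; have := Fmax M.+1; rewrite -FM leNgt lt.
    rewrite ltn_neqAle i0M andbT; apply/eqP => e.
    have FM0 : F M = F i0 by rewrite e.
    by have := lt_le_trans lt (Fmax _); rewrite -FM FM0 ltNge Fmin.
  - rewrite ltnSn /= ltn_neqAle; apply/andP; split; last lia.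
    apply/eqP => e; move: lt; rewrite e Fn => lt.
    by have := Fmin (M + i)%N; rewrite leNgt lt.
  - left; rewrite FM; split; split.
    + by apply: lt_le_trans (Fmax _); exact: le_lt_trans (Fmin _) lt.
    + exact: le_lt_trans (Fmin _) lt.
    + exact: lt_le_trans lt (Fmax _).
    + exact: lt.
rewrite !addn0 (subnKC i0M).
have -> : (i0 + (M - i0 + (n - (M - i0))))%N = (i0 + n)%N by lia.
by rewrite Fn; have := hW M i0; lra.
Qed.

End TotalVariation.

(** * Exposed points sorted into a convex polygon *)

Section ExposedPoints.
Context {R : realType} {I : finType} {y : I -> R * R}.
Local Notation plane := (R * R)%type.

Definition exposed (J : {set I}) (j : I) := exists v : plane,
  forall j', j' \in J -> j' != j -> dot (y j') v < dot (y j) v.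

(** The angular order given by the sign of [det2] is transitive only inside an open half plane, here
    the one defined by [v]; the values [dot _ v] are then weights of one sign in the linear relation
    between three vectors. *)
Lemma det2_trans (v a b c : plane) : dot a v < 0 -> dot b v < 0 -> dot c v < 0 ->
  0 <= det2 a b -> 0 <= det2 b c -> 0 <= det2 a c.
Proof.
move=> av bv cv ab bc; rewrite -(nmulr_rle0 _ bv).
have -> : dot b v * det2 a c = dot a v * det2 b c + dot c v * det2 a b.
  by rewrite /dot /det2; ring.
have h1 : dot a v * det2 b c <= 0 by rewrite mulr_le0_ge0// ltW.
have h2 : dot c v * det2 a b <= 0 by rewrite mulr_le0_ge0// ltW.
by lra.
Qed.

(** If the determinant vanished, [y j] and [y k] would lie on one ray from [y i], because [v]
    decreases strictly towards both. The one nearer to [y i] would then lie on the segment from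
    [y i] to the other and could not be exposed. *)
Lemma exposed_det2_neq0 (J : {set I}) i j k v :
  (forall j', j' \in J -> exposed J j') ->
  i \in J -> j \in J -> k \in J -> i != j -> i != k -> j != k ->
  dot (y j - y i) v < 0 -> dot (y k - y i) v < 0 ->
  det2 (y j - y i) (y k - y i) != 0.
Proof.
move=> exJ iJ jJ kJ ij ik jk jv kv; apply/eqP => d0.
have := det2_dot (y j - y i) (y k - y i) v; rewrite d0 scale0r.
move: jv kv; set la := dot (y j - y i) v; set mu := dot (y k - y i) v => jv kv e.
have [va hva] := exJ _ jJ; have [vb hvb] := exJ _ kJ.
have a1 : 0 < dot (y j - y i) va by rewrite dotBl subr_gt0 hva.
have a2 : dot (y k - y i) va < dot (y j - y i) va.
  by rewrite !dotBl ltrD2r hva// eq_sym.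
have b1 : 0 < dot (y k - y i) vb by rewrite dotBl subr_gt0 hvb.
have b2 : dot (y j - y i) vb < dot (y k - y i) vb by rewrite !dotBl ltrD2r hvb.
have ea : la * dot (y k - y i) va = mu * dot (y j - y i) va.
  by apply/eqP; rewrite -subr_eq0 -!dotZl -dotBl e /dot/= !mul0r addr0.
have eb : la * dot (y k - y i) vb = mu * dot (y j - y i) vb.
  by apply/eqP; rewrite -subr_eq0 -!dotZl -dotBl e /dot/= !mul0r addr0.
have lemu : la < mu.
  rewrite ltNge; apply/negP => le.
  by move: (dot (y j - y i) va) (dot (y k - y i) va) a1 a2 ea => X Y; nra.
by move: (dot (y k - y i) vb) (dot (y j - y i) vb) b1 b2 eb => X Y; nra.
Qed.

(** Otherwise [y j] would lie in the triangle [y p0], [y i], [y k], with quotients of determinants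
    as barycentric coordinates, and no functional could expose it. *)
Lemma exposed_det2_gt0 (J : {set I}) p0 i j k v :
  (forall j', j' \in J -> exposed J j') ->
  p0 \in J -> i \in J -> j \in J -> k \in J -> j != p0 -> j != i -> j != k ->
  0 < det2 (y i - y p0) (y j - y p0) -> 0 < det2 (y j - y p0) (y k - y p0) ->
  0 < det2 (y i - y p0) (y k - y p0) -> dot (y j - y p0) v < 0 ->
  0 < det2 (y j - y i) (y k - y i).
Proof.
move=> exJ p0J iJ jJ kJ jo ji jk; set a := y i - y p0; set b := y j - y p0.
set c := y k - y p0 => ab bc ac bv.
have -> : det2 (y j - y i) (y k - y i) = det2 b c + det2 a b - det2 a c.
  by rewrite /a /b /c /det2 /=; ring.
rewrite ltNge; apply/negP => le.
have [w hw] := exJ _ jJ.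
have bw : 0 < dot b w by rewrite dotBl subr_gt0 hw// eq_sym.
have abw : dot a w < dot b w by rewrite !dotBl ltrD2r hw// eq_sym.
have cbw : dot c w < dot b w by rewrite !dotBl ltrD2r hw// eq_sym.
have e : det2 a c * dot b w = det2 b c * dot a w + det2 a b * dot c w.
  by rewrite /dot /det2; ring.
by move: ab bc ac le bw abw cbw e; set A := det2 a b; set B := det2 b c;
  set C := det2 a c; nra.
Qed.

(* The points are sorted by angle around one of them, all the others lying in
   the open half plane given by a functional that exposes it. *)
Lemma exposed_polygon (J : {set I}) :
  (forall j, j \in J -> exposed J j) ->
  exists s : seq I, s =i J /\
    forall (j0 : I), convex_polygon (fun i : 'I_(size s) => y (nth j0 s i)).
Proof.
move=> exJ; have [->|[p0 p0J]] := set_0Vmem J.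
  by exists [::]; split => [i|j0 [] //]; rewrite !inE.
have [v hv] := exJ _ p0J.
have hv' j : j \in J -> j != p0 -> dot (y j - y p0) v < 0.
  by move=> jJ jo; rewrite dotBl subr_lt0 hv.
pose r := [rel i j | 0 <= det2 (y i - y p0) (y j - y p0)].
pose t := sort r (enum (J :\ p0)).
have tE j : (j \in t) = (j \in J :\ p0) by rewrite mem_sort mem_enum.
have tu : uniq t by rewrite sort_uniq enum_uniq.
have rtot : {in t &, total r}.
  move=> i j _ _ /=; have [ge0|lt /=] := leP 0 (det2 (y i - y p0) (y j - y p0)); first by [].
  by apply: ltW; move: lt; rewrite -oppr_gt0 => /lt_le_trans; apply;
    rewrite /det2; lra.
have rtr : {in t & &, transitive r}.
  move=> j i k; rewrite !tE !inE => /andP[jo jJ] /andP[io iJ] /andP[ko kJ] /=.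
  by apply: (@det2_trans v); exact: hv'.
have tsort : sorted r t.
  apply: (@sort_sorted_in _ (mem t)); last by apply/allP => i; rewrite mem_enum -tE.
  by move=> i j it jt; exact: rtot.
have tnth j0 i j : (i < j < size t)%N ->
    0 < det2 (y (nth j0 t i) - y p0) (y (nth j0 t j) - y p0).
  move=> /andP[ij jt]; have it := ltn_trans ij jt.
  have := mem_nth j0 it; have := mem_nth j0 jt; rewrite !tE !inE.
  move=> /andP[jo jJ] /andP[io iJ].
  rewrite lt_neqAle eq_sym; apply/andP; split.
    apply: (@exposed_det2_neq0 J p0 _ _ v) => //; rewrite 1?eq_sym//; try exact: hv'.
    by rewrite nth_uniq// gtn_eqF.
  have := @sorted_ltn_nth_in _ (mem t) r rtr j0 t _ tsort i j.
  by rewrite !inE; apply => //; apply/allP.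
exists (p0 :: t); split.
  by move=> j; rewrite inE tE !inE; case: eqVneq => [->|].
move=> j0 [i iP] [j jP] [k kP] /= /andP[ij jk].
case: j jP ij jk => // j jP ij; case: k kP => // k kP jk /=.
have kt : (k < size t)%N by [].
have jkn := @tnth j0 j k.
case: i iP ij => [|i] iP ij /=; first by apply: jkn; apply/andP; split.
have [jt it] : (j < size t)%N /\ (i < size t)%N by move: iP jP => /=; lia.
have := mem_nth j0 it; have := mem_nth j0 jt; have := mem_nth j0 kt.
rewrite !tE !inE => /andP[ko kJ] /andP[jo jJ] /andP[io iJ].
apply: (@exposed_det2_gt0 J p0 _ _ _ v) => //.
- by rewrite nth_uniq// gtn_eqF.
- by rewrite nth_uniq// ltn_eqF.
- by apply: tnth; rewrite jt andbT.
- by apply: tnth; rewrite kt andbT.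
- by apply: tnth; rewrite kt andbT; move: ij jk => /=; lia.
- exact: hv'.
Qed.

End ExposedPoints.

(** * Contact points and perimeter *)

Section Contact.
Context {R : realType}.
Local Notation plane := (R * R)%type.
Implicit Types (A : set plane) (x : plane -> plane) (u y z : plane).

(** The number [dot (x u) u] is the support function of [A] at [u], so a single map carries both the
    support function and the points where it is attained. *)
Definition contact A x := forall u,
  A (x u) /\ forall y, A y -> dot y u <= dot (x u) u.

Lemma continuous_dot u : continuous (fun y => dot y u).
Proof.
move=> y; apply: cvgD; apply: cvgMl; [exact: cvg_fst | exact: cvg_snd].
Qed.

(** Polygons that define the perimeter have their vertices in the closure of [A], possibly outside
    [A]. *)
Lemma contact_closure A x u y : contact A x -> closure A y ->
  dot y u <= dot (x u) u.
Proof.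
move=> hx; have cl : closed [set z | dot z u <= dot (x u) u].
  apply: (@closed_comp _ _ (fun z => dot z u) [set r | r <= _]).
    by move=> z _; exact: continuous_dot.
  exact: closed_le.
rewrite closureE; apply: (smallest_sub cl).
by move=> z /(hx u).2.
Qed.

Lemma interior_shift A y u : A° y -> exists2 t : R, 0 < t & A (y + t *: u).
Proof.
move=> Ay.
have cv : (fun t : R => y + t *: u) @ (0 : R)^'+ --> y + 0 *: u.
  apply: cvgD; first exact: cvg_cst.
  by apply: cvgZr_tmp; apply: cvg_at_right_filter; exact: cvg_id.
rewrite scale0r addr0 in cv.
have [t [At t0]] : exists t, A (y + t *: u) /\ 0 < t.
  apply: (@filter_ex _ (0 : R)^'+).
  near=> t; split; near: t; first exact: cv.
  exact: nbhs_right_gt.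
by exists t.
Unshelve. all: by end_near. Qed.

End Contact.

Section Perimeter.
Context {R : realType}.
Local Notation plane := (R * R)%type.
Implicit Types (A : set plane) (x : plane -> plane) (u y z : plane).

Lemma contact_boundary A x u : u != 0 -> contact A x -> boundary A (x u).
Proof.
move=> u0 hx; split; first by apply: subset_closure; exact: (hx u).1.
move=> /(interior_shift u)[t t0 /(hx u).2]; rewrite dotDl dotZl.
rewrite gerDl leNgt pmulr_rgt0//.
rewrite lt_neqAle dot_ge0 andbT eq_sym => /negPn/eqP d0.
move: u0; rewrite -pair_eqE /= negb_and.
move: d0; rewrite /dot -!expr2 => d0.
have u1 : u.1 ^+ 2 = 0.
  by apply/eqP; rewrite eq_le sqr_ge0 andbT -d0 lerDl sqr_ge0.
have u2 : u.2 ^+ 2 = 0 by rewrite u1 add0r in d0.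
by rewrite -sqrf_eq0 u1 -(sqrf_eq0 u.2) u2 eqxx.
Qed.

Lemma dir_neq0 m k : dir m k != 0 :> plane.
Proof.
apply/negP => /eqP e; have := dir_norm (R := R) m k; rewrite e /= !expr0n/= addr0.
by move/eqP; rewrite eq_sym oner_eq0.
Qed.

(** A mean of [fa], [fc] equals a mean of [fb], [fd], so neither pair lies below the other. In a
    convex quadrilateral both means are the value of a functional at the intersection of the
    diagonals. *)
Lemma mean_not_separated (A B C E fa fb fc fd : R) :
  0 < A -> 0 < B -> 0 < C -> 0 < E -> A + B = C + E ->
  A * fa + B * fc = C * fb + E * fd ->
  ~ ((fa < fb /\ fa < fd) /\ (fc < fb /\ fc < fd)).
Proof.
move=> A0 B0 C0 E0 e1 e [[h1 h2] [h3 h4]].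
have [le|le] := leP fb fd.
  have p1 : 0 < A * (fb - fa) by rewrite mulr_gt0// subr_gt0.
  have p2 : 0 < B * (fb - fc) by rewrite mulr_gt0// subr_gt0.
  have p3 : 0 <= E * (fd - fb) by rewrite mulr_ge0 ?subr_ge0// ltW.
  have : (A + B) * fb = (C + E) * fb by rewrite e1.
  by lra.
have p1 : 0 < A * (fd - fa) by rewrite mulr_gt0// subr_gt0.
have p2 : 0 < B * (fd - fc) by rewrite mulr_gt0// subr_gt0.
have p3 : 0 < C * (fb - fd) by rewrite mulr_gt0 ?subr_gt0.
have : (A + B) * fd = (C + E) * fd by rewrite e1.
by lra.
Qed.

(* The coefficients are those of the affine relation between four points. *)
Lemma convex_polygon_crossing n (p : 'I_n -> plane) u (a b c d : 'I_n) :
  convex_polygon p -> (a < b < c)%N -> (c < d)%N ->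
  let f i := dot (p i) u in
  ~ ((f a < f b /\ f a < f d) /\ (f c < f b /\ f c < f d) \/
     (f b < f a /\ f d < f a) /\ (f b < f c /\ f d < f c)).
Proof.
move=> cp /andP[ab bc] cd f.
have ac := ltn_trans ab bc; have bd := ltn_trans bc cd.
have := cp a b c; have := cp a b d; have := cp a c d; have := cp b c d.
rewrite ab bc cd ac bd => /(_ isT) h1 /(_ isT) h2 /(_ isT) h3 /(_ isT) h4.
pose D i j k := det2 (p j - p i) (p k - p i).
have e : D b c d * f a + D a b d * f c = D a c d * f b + D a b c * f d.
  by rewrite /D /f /det2 /dot/=; ring.
have e1 : D b c d + D a b d = D a c d + D a b c.
  by rewrite /D /det2 /=; ring.
move: e e1 h1 h2 h3 h4; rewrite -!/(D _ _ _).
move: (D b c d) (D a b d) (D a c d) (D a b c) (f a) (f b) (f c) (f d).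
move=> A B C E fa fb fc fd e e1 A0 C0 B0 E0.
case; first exact: mean_not_separated A0 B0 C0 E0 e1 e.
move=> [[h1 h2] [h3 h4]].
exact: (mean_not_separated C0 E0 A0 B0 (esym e1) (esym e)).
Qed.

End Perimeter.

Section PerimeterBounds.
Context {R : realType}.
Local Notation plane := (R * R)%type.
Implicit Types (A : set plane) (x : plane -> plane) (u y z : plane).

Definition width x u : R := dot (x u) u + dot (x (- u)) (- u).

Definition cyclic_ext n (p : 'I_n.+1 -> plane) u (k : nat) : R :=
  dot (p (inord (k %% n.+1))) u.

Lemma cyclic_extD n (p : 'I_n.+1 -> plane) u k :
  cyclic_ext p u (k + n.+1) = cyclic_ext p u k.
Proof. by rewrite /cyclic_ext modnDr. Qed.

Lemma cyclic_ext_ord n (p : 'I_n.+1 -> plane) u (i : 'I_n.+1) :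
  cyclic_ext p u i = dot (p i) u.
Proof. by rewrite /cyclic_ext modn_small// inord_val. Qed.

Lemma cyclic_ext_tv n (p : 'I_n.+1 -> plane) u :
  cyclic_tv (cyclic_ext p u) n.+1 =
  \sum_(i < n.+1) `|dot (p (ordS i) - p i) u|.
Proof.
apply: eq_bigr => i _; rewrite cyclic_ext_ord dotBl; congr (`|dot (p _) u - _|).
by apply: val_inj; rewrite /= inordK// ltn_pmod.
Qed.

Lemma sum_projections_le A x n (p : 'I_n.+1 -> plane) u : contact A x ->
  convex_polygon p -> (forall i, boundary A (p i)) ->
  \sum_(i < n.+1) `|dot (p (ordS i) - p i) u| <= 2 * width x u.
Proof.
move=> hx cp bp; rewrite -cyclic_ext_tv.
apply: unimodal_tv => //; first exact: cyclic_extD.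
- move=> a b c d abc cd; have dn : (d < n.+1)%N by lia.
  have [an bn cn] : [/\ (a < n.+1)%N, (b < n.+1)%N & (c < n.+1)%N] by split; lia.
  have := @convex_polygon_crossing _ _ p u (Ordinal an) (Ordinal bn)
    (Ordinal cn) (Ordinal dn) cp abc.
  by move=> /=; rewrite -!cyclic_ext_ord /crossing /=; apply; lia.
- move=> a b; rewrite /width /cyclic_ext -dotNr; apply: lerD.
    by apply: (contact_closure _ hx); case: (bp (inord (a %% n.+1))).
  by apply: (contact_closure _ hx); case: (bp (inord (b %% n.+1))).
Qed.

Lemma polygon_length_le A x m n (p : 'I_n -> plane) : (2 <= m)%N ->
  contact A x -> convex_polygon p -> (forall i, boundary A (p i)) ->
  polygon_length p * hcos m <=
  2 * hsin m * \sum_(k < m) width x (dir m k).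
Proof.
move=> m2 hx; have q0 : 0 < hsin m :> R := hsin_gt0 m2.
have w0 u : 0 <= width x u.
  rewrite /width dotNr subr_ge0 -[leRHS]opprK -[X in _ <= - X]dotNr lerNr.
  by rewrite -dotNr; exact: ((hx (- u)).2 _ (hx u).1).
case: n p => [|n] p cp bp.
  by rewrite /polygon_length big_ord0 mul0r !mulr_ge0 ?(ltW q0)// sumr_ge0.
rewrite /polygon_length big_distrl /=.
apply: (@le_trans _ _ (\sum_(i < n.+1)
    hsin m * \sum_(k < m) `|dot (p (ordS i) - p i) (dir m k)|)).
  by apply: ler_sum => i _; exact: sum_dot_dir_ge.
rewrite -big_distrr /= [2 * _]mulrC -mulrA ler_pM2l// exchange_big /= big_distrr /=.
by apply: ler_sum => k _; exact: (sum_projections_le _ hx).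
Qed.

(* In a minimal set of contact points that still touches every support line,
   each point is exposed, so that collinear and repeated vertices are excluded. *)
Lemma contact_polygon A x m : (2 <= m)%N -> contact A x ->
  exists n (p : 'I_n -> plane), [/\ convex_polygon p,
    forall i, boundary A (p i) &
    forall k, exists i, dot (p i) (dir m k) = dot (x (dir m k)) (dir m k)].
Proof.
move=> m2 hx; pose y (i : 'I_(m.*2)) := x (dir m i).
pose cov (J : {set 'I_(m.*2)}) :=
  [forall k : 'I_(m.*2), [exists j in J, dot (y j) (dir m k) == dot (y k) (dir m k)]].
have covT : cov (finset.setTfor 'I_(m.*2)).
  by apply/forallP => k; apply/existsP; exists k; rewrite inE eqxx.
have [J Jmin _] := minset_exists covT.
have [covJ minJ] := minsetP Jmin.
have exJ j : j \in J -> exposed (y := y) J j.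
  move=> jJ; have : ~~ cov (J :\ j).
    apply/negP => covj; have := minJ _ covj (subD1set _ _).
    by move=> e; move: jJ; rewrite -e !inE eqxx.
  (* A support line that loses contact when [j] is removed is touched by [y j] alone, so its normal
     exposes [y j]. *)
  rewrite negb_forall => /existsP[k]; rewrite negb_exists => /forallP nk.
  have lt j' : j' \in J -> j' != j -> dot (y j') (dir m k) < dot (y k) (dir m k).
    move=> j'J j'j; rewrite lt_neqAle (hx _).2 ?andbT; last exact: (hx _).1.
    by have := nk j'; rewrite !inE j'j j'J.
  exists (dir m k) => j' j'J j'j; rewrite (lt_le_trans (lt _ j'J j'j))//.
  have /existsP[j1 /andP[j1J /eqP e1]] := forallP covJ k.
  have [<-|j1j] := eqVneq j1 j; first by rewrite e1.
  by have := lt _ j1J j1j; rewrite e1 ltxx.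
have [s [sJ cs]] := exposed_polygon exJ.
have m0 : (0 < m.*2)%N by lia.
pose j0 := Ordinal m0.
exists (size s), (fun i : 'I_(size s) => y (nth j0 s i)); split => //.
  by move=> i; apply: contact_boundary => //; exact: dir_neq0.
move=> k; pose k' := Ordinal (ltn_pmod k m0).
have kE : dir m k' = dir m k :> plane.
  rewrite /= [in RHS](divn_eq k m.*2); elim: (k %/ m.*2)%N => [|c IH] //.
  by rewrite mulSn -addnA addnC dirD2m.
have /existsP[j /andP[jJ /eqP e]] := forallP covJ k'.
rewrite -sJ in jJ; have js : (index j s < size s)%N by rewrite index_mem.
by exists (Ordinal js); rewrite /= nth_index// -kE e.
Qed.

Lemma polygon_length_ge A x m : (2 <= m)%N -> contact A x ->
  exists n (p : 'I_n -> plane), [/\ convex_polygon p,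
    forall i, boundary A (p i) &
    2 * hsin m * \sum_(k < m) width x (dir m k) <= polygon_length p].
Proof.
move=> m2 hx; have [n [p [cp bp hp]]] := contact_polygon m2 hx.
exists n, p; split => //; case: n p cp bp hp => [|n] p cp bp hp.
  by have [[]] := hp 0%N.
rewrite [2 * _]mulrC -mulrA.
apply: (@le_trans _ _ (\sum_(i < n.+1)
    hsin m * \sum_(k < m) `|dot (p (ordS i) - p i) (dir m k)|)).
  rewrite -big_distrr /= ler_pM2l ?hsin_gt0// exchange_big /= big_distrr /=.
  apply: ler_sum => k _; rewrite -cyclic_ext_tv.
  have [a ea] := hp k; have [b] := hp (k + m)%N; rewrite dirDm ?(ltnW m2)// => eb.
  have := @cyclic_tv_ge _ _ n.+1 a b (cyclic_extD p (dir m k)) (ltn_ord a) (ltn_ord b).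
  by rewrite !cyclic_ext_ord /width ea -eb dotNr.
by apply: ler_sum => i _; exact: sum_dot_dir_le.
Qed.

(** A discrete Cauchy formula: [2 * hsin m] is asymptotic to the step [pi / m], so the sum
    approximates the integral of the width over a half turn. The case [m = 2] already makes the
    perimeter finite. *)
Lemma perimeter_bounds A x : contact A x -> exists P : R,
  perimeter A = P%:E /\ forall m, (2 <= m)%N ->
    2 * hsin m * \sum_(k < m) width x (dir m k) <= P /\
    P * hcos m <= 2 * hsin m * \sum_(k < m) width x (dir m k).
Proof.
move=> hx.
have ub m : (2 <= m)%N -> (perimeter A <=
    ((2 * hsin m * \sum_(k < m) width x (dir m k)) / hcos m)%:E)%E.
  move=> m2; apply: ge_ereal_sup => _ [n [p [cp bp ->]]].
  by rewrite lee_fin ler_pdivlMr ?hcos_gt0//; exact: (polygon_length_le _ hx).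
have lb m : (2 <= m)%N -> ((2 * hsin m * \sum_(k < m) width x (dir m k))%:E <=
    perimeter A)%E.
  move=> m2; have [n [p [cp bp le]]] := polygon_length_ge m2 hx.
  apply: (@le_trans _ _ (polygon_length p)%:E); first by rewrite lee_fin.
  by apply: ereal_sup_ubound; exists n, p; split.
have fin : perimeter A \is a fin_num.
  rewrite fin_real//; apply/andP; split.
    by apply: lt_le_trans (lb 2%N isT); rewrite ltNyr.
  by apply: le_lt_trans (ub 2%N isT) _; rewrite ltry.
exists (fine (perimeter A)); split; first by rewrite fineK.
move=> m m2; split; first by rewrite -lee_fin fineK// lb.
by rewrite -ler_pdivlMr ?hcos_gt0// -lee_fin fineK// ub.
Qed.

End PerimeterBounds.

(** * Areas of regions between chains *)

Section PlaneMeasure.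
Context {R : realType}.
Local Notation plane := (R * R)%type.
Local Notation mu := (@lebesgue_measure R).
Local Notation area := (@area R).

Lemma open_measurable_plane (A : set plane) : open A -> measurable A.
Proof.
move=> oA.
pose box (q : (rat * rat) * (rat * rat)) : set plane :=
  `]ratr q.1.1, ratr q.1.2[%classic `*` `]ratr q.2.1, ratr q.2.2[%classic.
pose F q := if `[< box q `<=` A >] then box q else set0.
have -> : A = \bigcup_q F q.
  apply/seteqP; split => [[a b] Aab|z [q _]]; last first.
    by rewrite /F; case: asboolP => [qA bz|_ []]; exact: qA.
  have /nbhs_ballP[e /= e0 be] : nbhs (a, b) A by exact: open_nbhs_nbhs.
  have [q1 q1P] := @rat_in_itvoo R (a - e) a ltac:(lra).
  have [q2 q2P] := @rat_in_itvoo R a (a + e) ltac:(lra).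
  have [q3 q3P] := @rat_in_itvoo R (b - e) b ltac:(lra).
  have [q4 q4P] := @rat_in_itvoo R b (b + e) ltac:(lra).
  move: q1P q2P q3P q4P; rewrite !in_itv/= => /andP[h1 h2] /andP[h3 h4].
  move=> /andP[h5 h6] /andP[h7 h8].
  exists ((q1, q2), (q3, q4)) => //; rewrite /F; case: asboolP => [_|[]].
    by split; rewrite /= in_itv/=; apply/andP; split.
  move=> [x y] [] /=; rewrite !in_itv/= => /andP[x1 x2] /andP[y1 y2].
  apply: be; split; rewrite /ball/= ltr_norml; apply/andP; split; lra.
apply: countable_bigcupT_measurable => [|q]; first exact: countableP.
rewrite /F; case: asboolP => _; last exact: measurable0.
by apply: measurableX; exact: measurable_itv.
Qed.

Lemma closed_measurable_plane (A : set plane) : closed A -> measurable A.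
Proof.
by move=> cA; rewrite -[A]setCK; apply: measurableC; apply: open_measurable_plane;
  rewrite openC.
Qed.

Lemma integral_affine (s t a b : R) : s < t ->
  (\int[mu]_(x in `[s, t]) (a + b * (x - s))%:E =
   ((t - s) * a + b * (t - s) ^+ 2 / 2)%:E)%E.
Proof.
move=> st; pose F x := a * x + b / 2 * ((x - s) * (x - s)).
have dF (x : R) : is_derive x 1 F (a + b * (x - s)).
  rewrite /F; apply: is_derive_eq.
  by rewrite subr0 /GRing.scale /=; field.
have dF1 x : derivable F x 1 by case: (dF x).
have cF : continuous F.
  move=> x; apply: differentiable_continuous; apply/derivable1_diffP.
  exact: dF1.
rewrite (@continuous_FTC2 _ _ F)//.
- by congr EFin; rewrite /F; field.
- apply: continuous_subspaceT => x; apply: cvgD; first exact: cvg_cst.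
  by apply: cvgMl_tmp; apply: cvgB; [exact: cvg_id|exact: cvg_cst].
- split; first by move=> x _; exact: dF1.
    exact/cvg_at_right_filter/cF.
  exact/cvg_at_left_filter/cF.
- by move=> x _; rewrite derive1E; case: (dF x).
Qed.

Lemma area_affine_strip (s t a0 a1 b0 b1 : R) : s < t ->
  (forall x, s <= x <= t -> a0 + a1 * (x - s) <= b0 + b1 * (x - s)) ->
  area [set z | s <= z.1 <= t /\
    a0 + a1 * (z.1 - s) <= z.2 <= b0 + b1 * (z.1 - s)] =
  ((t - s) * (b0 - a0) + (b1 - a1) * (t - s) ^+ 2 / 2)%:E.
Proof.
move=> st hle; rewrite -integral_affine// integral_mkcond.
rewrite /Defs.area /product_measure1; apply: eq_integral => x _ /=.
rewrite patchE mem_setE in_itv/=.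
case: ifPn => xst.
  rewrite (_ : xsection _ _ = `[a0 + a1 * (x - s), b0 + b1 * (x - s)]%classic); last first.
    apply/seteqP; split => y; rewrite /= /xsection /= inE /= in_itv/=.
      by case.
    by move=> h; split.
  rewrite lebesgue_measure_itv/= lte_fin; case: ltP => [lt|ge].
    by rewrite -EFinD; congr EFin; ring.
  have e : a0 + a1 * (x - s) = b0 + b1 * (x - s).
    by apply/eqP; rewrite eq_le hle.
  by congr EFin; move: e; lra.
rewrite (_ : xsection _ _ = set0) ?measure0//.
apply/seteqP; split => y //; rewrite /= /xsection /= inE /= => -[h _].
by rewrite h in xst.
Qed.

End PlaneMeasure.

(** * Vertical trapezoids under and over an edge *)

Section Chains.
Context {R : realType}.
Local Notation plane := (R * R)%type.
Local Notation area := (@area R).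
Implicit Types (z w p : plane).

Lemma closed_le_fun (f g : plane -> R) : continuous f -> continuous g ->
  closed [set p | f p <= g p].
Proof.
move=> cf cg; rewrite (_ : [set _ | _] = (fun p => g p - f p) @^-1` [set r | 0 <= r]).
  apply: closed_comp; last exact: closed_ge.
  by move=> p _; apply: cvgB; [exact: cg|exact: cf].
by apply/seteqP; split => p /=; rewrite subr_ge0.
Qed.

Lemma continuous_det2 w z : continuous (fun p => det2 w (p - z)).
Proof.
move=> p; apply: cvgB; apply: cvgMl_tmp; apply: cvgB; try exact: cvg_cst.
  exact: cvg_snd.
exact: cvg_fst.
Qed.

(** The vertex [w] is the left end of the edge, and the determinant tests the left side of the edge
    run from [z] to [w], which is the lower side. Unlike a slope, it also makes sense for a vertical
    edge, where the set is contained in a vertical line. *)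
Definition trap_below c z w : set plane :=
  [set p | [/\ w.1 <= p.1, p.1 <= z.1, c <= p.2 & 0 <= det2 (w - z) (p - z)]].

Definition trap_above d w z : set plane :=
  [set p | [/\ w.1 <= p.1, p.1 <= z.1, p.2 <= d & 0 <= det2 (z - w) (p - w)]].

Let cfst : continuous (fun p : plane => p.1). Proof. by move=> p; exact: cvg_fst. Qed.
Let csnd : continuous (fun p : plane => p.2). Proof. by move=> p; exact: cvg_snd. Qed.
Let ccst (a : R) : continuous (fun p : plane => a). Proof. by move=> p; exact: cvg_cst. Qed.

Lemma measurable_trap_below c z w : measurable (trap_below c z w).
Proof.
apply: closed_measurable_plane.
rewrite (_ : trap_below _ _ _ = [set p | w.1 <= p.1] `&` [set p | p.1 <= z.1] `&`
    ([set p | c <= p.2] `&` [set p | 0 <= det2 (w - z) (p - z)])); last first.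
  by apply/seteqP; split => p /=; [case|case=> -[? ?] [? ?]; split].
apply: closedI; apply: closedI; apply: closed_le_fun => //.
exact: continuous_det2.
Qed.

Lemma measurable_trap_above d w z : measurable (trap_above d w z).
Proof.
apply: closed_measurable_plane.
rewrite (_ : trap_above _ _ _ = [set p | w.1 <= p.1] `&` [set p | p.1 <= z.1] `&`
    ([set p | p.2 <= d] `&` [set p | 0 <= det2 (z - w) (p - w)])); last first.
  by apply/seteqP; split => p /=; [case|case=> -[? ?] [? ?]; split].
apply: closedI; apply: closedI; apply: closed_le_fun => //.
exact: continuous_det2.
Qed.

Lemma area_vertical_line (a : R) : area ([set a] `*` setT) = 0%E.
Proof.
transitivity (lebesgue_measure [set a] * lebesgue_measure (setT : set R))%E.
  by apply: product_measure1E => //; exact: measurable_set1.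
by rewrite lebesgue_measure_set1 mul0e.
Qed.

Lemma le_area (A B : set plane) : measurable A -> measurable B -> A `<=` B ->
  (area A <= area B)%E.
Proof. by move=> mA mB AB; apply: le_measure; rewrite ?inE. Qed.

Lemma area_trap_below c z w : w.1 <= z.1 -> c <= w.2 -> c <= z.2 ->
  (area (trap_below c z w) <=
   ((z.1 - w.1) * ((z.2 + w.2) / 2 - c))%:E)%E.
Proof.
rewrite le_eqVlt => /predU1P[wz|wz] cw cz.
  rewrite wz subrr mul0r (_ : 0%:E = area ([set z.1] `*` setT)); last first.
    by rewrite area_vertical_line.
  apply: le_area.
  - exact: measurable_trap_below.
  - by apply: measurableX => //; exact: measurable_set1.
  - by move=> p [h1 h2 _ _]; split => //=; apply/eqP; rewrite eq_le h2 -wz h1.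
have dw : 0 < z.1 - w.1 by rewrite subr_gt0.
have [k kE] : exists k, k * (z.1 - w.1) = z.2 - w.2.
  by exists ((z.2 - w.2) / (z.1 - w.1)); rewrite divfK// gt_eqF.
have e y : (z.1 - w.1) * (w.2 + k * (y - w.1)) =
    (z.1 - w.1) * w.2 + (z.2 - w.2) * (y - w.1) by rewrite -kE; ring.
rewrite (_ : trap_below _ _ _ = [set p | w.1 <= p.1 <= z.1 /\
    c + 0 * (p.1 - w.1) <= p.2 <= w.2 + k * (p.1 - w.1)]).
  rewrite area_affine_strip//.
    rewrite lee_fin subr0 (_ : k * (z.1 - w.1) ^+ 2 = (z.2 - w.2) * (z.1 - w.1)).
      by lra.
    by rewrite expr2 mulrA kE.
  move=> x /andP[h1 h2]; rewrite mul0r addr0.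
  rewrite -subr_ge0 -(pmulr_rge0 _ dw) mulrBr e.
  nra.
apply/seteqP; split => p /=.
  move=> [h1 h2 h3 h4]; rewrite h1 h2 mul0r addr0 h3; split => //=.
  rewrite -subr_ge0 -(pmulr_rge0 _ dw) mulrBr e.
  by move: h4; rewrite /det2 /=; lra.
move=> [/andP[h1 h2]]; rewrite mul0r addr0 => /andP[h3 h4]; split => //.
move: h4; rewrite -subr_ge0 -(pmulr_rge0 _ dw) mulrBr e.
by rewrite /det2 /=; lra.
Qed.

Lemma area_trap_above d w z : w.1 <= z.1 -> w.2 <= d -> z.2 <= d ->
  (area (trap_above d w z) <=
   ((z.1 - w.1) * (d - (z.2 + w.2) / 2))%:E)%E.
Proof.
rewrite le_eqVlt => /predU1P[wz|wz] dw' dz.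
  rewrite wz subrr mul0r (_ : 0%:E = area ([set z.1] `*` setT)); last first.
    by rewrite area_vertical_line.
  apply: le_area.
  - exact: measurable_trap_above.
  - by apply: measurableX => //; exact: measurable_set1.
  - by move=> p [h1 h2 _ _]; split => //=; apply/eqP; rewrite eq_le h2 -wz h1.
have dw : 0 < z.1 - w.1 by rewrite subr_gt0.
have [k kE] : exists k, k * (z.1 - w.1) = z.2 - w.2.
  by exists ((z.2 - w.2) / (z.1 - w.1)); rewrite divfK// gt_eqF.
have e y : (z.1 - w.1) * (w.2 + k * (y - w.1)) =
    (z.1 - w.1) * w.2 + (z.2 - w.2) * (y - w.1) by rewrite -kE; ring.
rewrite (_ : trap_above _ _ _ = [set p | w.1 <= p.1 <= z.1 /\
    w.2 + k * (p.1 - w.1) <= p.2 <= d + 0 * (p.1 - w.1)]).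
  rewrite area_affine_strip//.
    rewrite lee_fin sub0r mulNr (_ : k * (z.1 - w.1) ^+ 2 = (z.2 - w.2) * (z.1 - w.1)).
      by lra.
    by rewrite expr2 mulrA kE.
  move=> x /andP[h1 h2]; rewrite mul0r addr0.
  rewrite -subr_ge0 -(pmulr_rge0 _ dw) mulrBr e.
  nra.
apply/seteqP; split => p /=.
  move=> [h1 h2 h3 h4]; rewrite h1 h2 mul0r addr0 h3 andbT; split => //=.
  rewrite -subr_ge0 -(pmulr_rge0 _ dw) mulrBr e.
  by move: h4; rewrite /det2 /=; lra.
move=> [/andP[h1 h2]]; rewrite mul0r addr0 => /andP[h4 h3]; split => //.
move: h4; rewrite -subr_ge0 -(pmulr_rge0 _ dw) mulrBr e.
by rewrite /det2 /=; lra.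
Qed.

Lemma chain_cell (f : nat -> R) n x : f n.+1 <= x <= f 0%N ->
  exists2 k, (k < n.+1)%N & f k.+1 <= x <= f k.
Proof.
elim: n => [|n IH] /andP[fn f0]; first by exists 0%N => //; rewrite fn f0.
have [le|lt] := leP (f n.+1) x.
  by have [|k kn fk] := IH; [rewrite le|exists k => //; exact: ltnW].
by exists n.+1 => //; rewrite fn ltW.
Qed.

End Chains.

Lemma convex_comb (R : realType) (A : set (R * R)) z w (t : R) : convex_set A ->
  A z -> A w -> 0 <= t <= 1 -> A (t *: z + (1 - t) *: w).
Proof.
move=> cA Az Aw /andP[t0 t1].
by have := cA z w (Itv01 t0 t1); rewrite !inE; apply.
Qed.

(** The strict inequality is the cross-multiplied form of [(x, y)] lying below the chord; being
    strict, it excludes a vertical chord. *)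
Lemma segment_above (R : realType) (A : set (R * R)) z w (x y : R) :
  A z -> A w -> convex_set A -> w.1 <= x <= z.1 ->
  0 < (z.1 - x) * (w.2 - y) + (x - w.1) * (z.2 - y) ->
  exists2 y', A (x, y') & y < y'.
Proof.
move=> Az Aw cA /andP[x1 x2] pos.
have D0 : 0 < z.1 - w.1.
  rewrite lt_neqAle subr_ge0 (le_trans x1 x2) andbT eq_sym subr_eq0.
  apply/eqP => e; have ez : x = z.1 by lra.
  by move: pos; rewrite ez -e !subrr !mul0r addr0 ltxx.
have h := @convex_comb _ A z w ((x - w.1) / (z.1 - w.1)) cA Az Aw.
exists (((x - w.1) * z.2 + (z.1 - x) * w.2) / (z.1 - w.1)); last first.
  by rewrite ltr_pdivlMr//; lra.
have -> : (x, ((x - w.1) * z.2 + (z.1 - x) * w.2) / (z.1 - w.1)) =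
    ((x - w.1) / (z.1 - w.1)) *: z + (1 - (x - w.1) / (z.1 - w.1)) *: w.
  by rewrite !pairZ; congr pair => /=; field; rewrite gt_eqF.
apply: h; rewrite ler_pdivlMr// mul0r ler_pdivrMr// mul1r.
by apply/andP; split; lra.
Qed.

Lemma segment_below (R : realType) (A : set (R * R)) w z (x y : R) :
  A w -> A z -> convex_set A -> w.1 <= x <= z.1 ->
  (z.1 - x) * (w.2 - y) + (x - w.1) * (z.2 - y) < 0 ->
  exists2 y', A (x, y') & y' < y.
Proof.
move=> Aw Az cA /andP[x1 x2] pos.
have D0 : 0 < z.1 - w.1.
  rewrite lt_neqAle subr_ge0 (le_trans x1 x2) andbT eq_sym subr_eq0.
  apply/eqP => e; have ez : x = z.1 by lra.
  by move: pos; rewrite ez -e !subrr !mul0r addr0 ltxx.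
have h := @convex_comb _ A z w ((x - w.1) / (z.1 - w.1)) cA Az Aw.
exists (((x - w.1) * z.2 + (z.1 - x) * w.2) / (z.1 - w.1)); last first.
  by rewrite ltr_pdivrMr//; lra.
have -> : (x, ((x - w.1) * z.2 + (z.1 - x) * w.2) / (z.1 - w.1)) =
    ((x - w.1) / (z.1 - w.1)) *: z + (1 - (x - w.1) / (z.1 - w.1)) *: w.
  by rewrite !pairZ; congr pair => /=; field; rewrite gt_eqF.
apply: h; rewrite ler_pdivlMr// mul0r ler_pdivrMr// mul1r.
by apply/andP; split; lra.
Qed.

(** * Area enclosed by a closed chain *)

Section ChainArea.
Context {R : realType}.
Local Notation plane := (R * R)%type.
Local Notation area := (@area R).
Implicit Types (z w p : plane) (A B : set plane).

Lemma area_ge0 A : (0 <= area A)%E.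
Proof. exact: measure_ge0. Qed.

Lemma area_bounded_fin A (r : R) : (area A <= r%:E)%E ->
  exists2 a : R, area A = a%:E & a <= r.
Proof.
move=> Ar; have fA : area A \is a fin_num.
  by rewrite ge0_fin_numE ?area_ge0//; apply: le_lt_trans Ar _; rewrite ltry.
by exists (fine (area A)); [rewrite fineK|rewrite -lee_fin fineK].
Qed.

Lemma area_bigcup_le n (F : nat -> set plane) (r : nat -> R) :
  (forall i, (i < n)%N -> measurable (F i) /\ (area (F i) <= (r i)%:E)%E) ->
  (area (\big[setU/set0]_(i < n) F i) <= (\sum_(i < n) r i)%:E)%E.
Proof.
move=> h; rewrite -sumEFin; apply: (@le_trans _ _ (\sum_(i < n) area (F i))%E).
  by apply: Boole_inequality => i /h [].
by apply: lee_sum => i _; case: (h i (ltn_ord i)).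
Qed.

Lemma area_setU A B : measurable A -> measurable B -> (area A < +oo)%E ->
  area (A `|` B) = (area A + area B - area (A `&` B))%E.
Proof. by move=> mA mB fA; apply: measureUfinl. Qed.

Lemma area_setU_le A B : measurable A -> measurable B ->
  (area (A `|` B) <= area A + area B)%E.
Proof. by move=> mA mB; apply: measureU2. Qed.

Lemma area_rectangle (a b c d : R) : a <= b -> c <= d ->
  area (`[a, b] `*` `[c, d]) = ((b - a) * (d - c))%:E.
Proof.
move=> ab cd; have itvE (u v : R) : u <= v ->
    lebesgue_measure (`[u, v]%classic : set R) = (v - u)%:E.
  move=> uv; rewrite lebesgue_measure_itv/= lte_fin; case: ltP => // vu.
  by rewrite (_ : u = v) ?subrr//; apply/eqP; rewrite eq_le uv.
transitivity (lebesgue_measure (`[a, b]%classic : set R) *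
    lebesgue_measure (`[c, d]%classic : set R))%E.
  by apply: product_measure1E => //; exact: measurable_itv.
by rewrite !itvE// -EFinM.
Qed.

(* A closed chain that runs from right to left along its first [m] edges and
   back along the last [m] ones. *)
Variables (m : nat) (Z : nat -> plane).
Hypothesis m_gt0 : (0 < m)%N.
Hypothesis Zl : forall k, (k < m)%N -> (Z k.+1).1 <= (Z k).1.
Hypothesis Zr : forall k, (m <= k < m.*2)%N -> (Z k).1 <= (Z k.+1).1.
Hypothesis Zc : Z m.*2 = Z 0.

(** The shoelace formula for a counterclockwise chain, as signed trapezoids standing on the
    horizontal axis. *)
Definition trapezoid_sum : R :=
  \sum_(k < m.*2) ((Z k).1 - (Z k.+1).1) * (((Z k).2 + (Z k.+1).2) / 2).

(** Holds for [c] and [d] in either order: the upper bound on the area uses it as it stands, the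
    lower bound with the two exchanged, which reverses the sign of every trapezoid. *)
Let trapezoid_sumE c d :
  \sum_(k < m) ((Z k).1 - (Z k.+1).1) * (((Z k).2 + (Z k.+1).2) / 2 - c) +
  \sum_(k < m) ((Z (m + k).+1).1 - (Z (m + k)).1) *
     (d - ((Z (m + k).+1).2 + (Z (m + k)).2) / 2) =
  trapezoid_sum + ((Z 0).1 - (Z m).1) * (d - c).
Proof.
have telL n : \sum_(k < n) ((Z k).1 - (Z k.+1).1) = (Z 0).1 - (Z n).1.
  by elim: n => [|n IH]; rewrite ?big_ord0 ?subrr// big_ord_recr /= IH; ring.
have telR n : \sum_(k < n) ((Z (m + k).+1).1 - (Z (m + k)).1) =
    (Z (m + n)).1 - (Z m).1.
  elim: n => [|n IH]; first by rewrite big_ord0 addn0 subrr.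
  by rewrite big_ord_recr /= IH addnS; ring.
have eL : \sum_(k < m) ((Z k).1 - (Z k.+1).1) * (((Z k).2 + (Z k.+1).2) / 2 - c) =
    \sum_(k < m) ((Z k).1 - (Z k.+1).1) * (((Z k).2 + (Z k.+1).2) / 2) -
    ((Z 0).1 - (Z m).1) * c.
  by rewrite -(telL m) big_distrl -sumrB; apply: eq_bigr => k _ /=; ring.
have eR : \sum_(k < m) ((Z (m + k).+1).1 - (Z (m + k)).1) *
     (d - ((Z (m + k).+1).2 + (Z (m + k)).2) / 2) =
    \sum_(k < m) ((Z (m + k)).1 - (Z (m + k).+1).1) *
       (((Z (m + k)).2 + (Z (m + k).+1).2) / 2) +
    ((Z (m + m)).1 - (Z m).1) * d.
  by rewrite -(telR m) big_distrl -big_split; apply: eq_bigr => k _ /=; ring.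
rewrite eL eR addnn Zc /trapezoid_sum -addnn big_split_ord /=; ring.
Qed.

Let bounds M : 0 <= M -> exists c d : R, [/\ c <= - M, M <= d &
  forall k, (k <= m.*2)%N -> c <= (Z k).2 <= d].
Proof.
move=> M0; pose d := M + \sum_(k < m.*2.+1) `|(Z k).2|.
have S0 : 0 <= \sum_(k < m.*2.+1) `|(Z k).2| by apply: sumr_ge0.
exists (- d), d; split; [rewrite /d; lra|rewrite /d; lra|].
move=> k km; rewrite -ler_norml.
have km1 : (k < m.*2.+1)%N by [].
rewrite /d (bigD1 (Ordinal km1)) //=.
have : 0 <= \sum_(i < m.*2.+1 | i != Ordinal km1) `|(Z i).2| by apply: sumr_ge0.
by lra.
Qed.

Let Z_width : (Z m).1 <= (Z 0).1.
Proof.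
suff h n : (n <= m)%N -> (Z n).1 <= (Z 0).1 by exact: h.
elim: n => // n IH nm; apply: le_trans (IH (ltnW nm)); exact: Zl.
Qed.

Let topcell x : (Z m).1 <= x <= (Z 0).1 ->
  exists2 k, (k < m)%N & (Z k.+1).1 <= x <= (Z k).1.
Proof.
have mE : m.-1.+1 = m by rewrite prednK.
by rewrite -{1}mE => /(@chain_cell _ (fun k => (Z k).1)); rewrite mE.
Qed.

Let botcell x : (Z m).1 <= x <= (Z 0).1 ->
  exists2 k, (k < m)%N & (Z (m + k)).1 <= x <= (Z (m + k).+1).1.
Proof.
have mE : m.-1.+1 = m by rewrite prednK.
move=> /andP[x1 x2].
have [|k] := @chain_cell _ (fun k => - (Z (m + k)).1) m.-1 (- x).
  by rewrite mE addnn Zc addn0 !lerN2 x2.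
by rewrite mE addnS !lerN2 => km /andP[h1 h2]; exists k => //; rewrite h1 h2.
Qed.

(* The trapezoids below the upper chain and those above the lower chain
   intersect in a superset of [A] and cover the whole rectangle. *)
Lemma area_le_chain A (M : R) : measurable A ->
  (forall p, A p -> `|p.2| <= M) ->
  (forall p, A p -> (Z m).1 <= p.1 <= (Z 0).1) ->
  (forall x, (Z m).1 <= x <= (Z 0).1 -> exists y, A (x, y)) ->
  (forall k p, (k < m.*2)%N -> A p -> 0 <= det2 (Z k.+1 - Z k) (p - Z k)) ->
  (area A <= trapezoid_sum%:E)%E.
Proof.
move=> mA AM AZ Asec Aedge.
have M0 : 0 <= M.
  have [|y /AM] := Asec (Z m).1; first by rewrite lexx.
  exact: le_trans.
have [c [d [cM Md Zcd]]] := bounds M0.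
pose B1 := \big[setU/set0]_(k < m) trap_below c (Z k) (Z k.+1).
pose B2 := \big[setU/set0]_(k < m) trap_above d (Z (m + k)%N) (Z (m + k).+1).
have mB1 : measurable B1.
  by apply: bigsetU_measurable => k _; exact: measurable_trap_below.
have mB2 : measurable B2.
  by apply: bigsetU_measurable => k _; exact: measurable_trap_above.
have B1P k p : (k < m)%N -> trap_below c (Z k) (Z k.+1) p -> B1 p.
  move=> km Tp; rewrite /B1 -(bigcup_mkord _ (fun k => trap_below c (Z k) (Z k.+1))).
  by exists k.
have B2P k p : (k < m)%N -> trap_above d (Z (m + k)%N) (Z (m + k).+1) p -> B2 p.
  move=> km Tp.
  rewrite /B2 -(bigcup_mkord _ (fun k => trap_above d (Z (m + k)%N) (Z (m + k).+1))).
  by exists k.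
have aB1 : (area B1 <= (\sum_(k < m) ((Z k).1 - (Z k.+1).1) *
    (((Z k).2 + (Z k.+1).2) / 2 - c))%:E)%E.
  apply: (@area_bigcup_le _ (fun k => trap_below c (Z k) (Z k.+1))
    (fun k => ((Z k).1 - (Z k.+1).1) * (((Z k).2 + (Z k.+1).2) / 2 - c))).
  move=> k km; split; first exact: measurable_trap_below.
  have /andP[c1 _] : c <= (Z k).2 <= d by apply: Zcd; lia.
  have /andP[c2 _] : c <= (Z k.+1).2 <= d by apply: Zcd; lia.
  by apply: area_trap_below => //; exact: Zl.
have aB2 : (area B2 <= (\sum_(k < m) ((Z (m + k).+1).1 - (Z (m + k)).1) *
     (d - ((Z (m + k).+1).2 + (Z (m + k)).2) / 2))%:E)%E.
  apply: (@area_bigcup_le _ (fun k => trap_above d (Z (m + k)%N) (Z (m + k).+1))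
    (fun k => ((Z (m + k).+1).1 - (Z (m + k)).1) *
     (d - ((Z (m + k).+1).2 + (Z (m + k)).2) / 2))).
  move=> k km; split; first exact: measurable_trap_above.
  have /andP[_ c1] : c <= (Z (m + k)).2 <= d by apply: Zcd; lia.
  have /andP[_ c2] : c <= (Z (m + k).+1).2 <= d by apply: Zcd; lia.
  by apply: area_trap_above => //; apply: Zr; lia.
have [b1 eb1 lb1] := area_bounded_fin aB1.
have [b2 eb2 lb2] := area_bounded_fin aB2.
have AB : A `<=` B1 `&` B2.
  move=> p Ap; have := AM _ Ap; rewrite ler_norml => /andP[p1 p2]; split.
    have [k km /andP[h1 h2]] := topcell (AZ _ Ap).
    apply: (B1P k) => //; split => //; first by apply: le_trans p1.
    by apply: Aedge => //; move: km; clear; lia.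
  have [k km /andP[h1 h2]] := botcell (AZ _ Ap).
  apply: (B2P k) => //; split => //; first by apply: le_trans Md.
  by apply: Aedge => //; move: km; clear; lia.
have RB : `[(Z m).1, (Z 0).1] `*` `[c, d] `<=` B1 `|` B2.
  move=> [x y] [] /=; rewrite !in_itv/= => xZ /andP[cy yd].
  have [y0 Ay0] := Asec _ xZ; have [le|/ltW le] := leP y y0.
    left; have [k km /andP[h1 h2]] := topcell xZ; apply: (B1P k) => //.
    split => //=; have : 0 <= det2 (Z k.+1 - Z k) ((x, y0) - Z k).
      by apply: Aedge => //; move: km; clear; lia.
    have : 0 <= ((Z k.+1).1 - (Z k).1) * (y - y0).
      by rewrite mulr_le0// subr_le0// Zl.
    by rewrite /det2 /= ; lra.
  right; have [k km /andP[h1 h2]] := botcell xZ; apply: (B2P k) => //.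
  split => //=; have : 0 <= det2 (Z (m + k).+1 - Z (m + k)) ((x, y0) - Z (m + k)).
    by apply: Aedge => //; move: km; clear; lia.
  have : 0 <= ((Z (m + k).+1).1 - (Z (m + k)).1) * (y - y0).
    by rewrite mulr_ge0// subr_ge0//; apply: Zr; move: km; clear; lia.
  by rewrite /det2 /=; lra.
have mI : measurable (B1 `&` B2) by exact: measurableI.
have aI : (area (B1 `&` B2) <= b1%:E)%E.
  by rewrite -eb1; apply: le_area => //; exact: subIsetl.
have [i ei _] := area_bounded_fin aI.
have aA : (area A <= i%:E)%E by rewrite -ei; exact: le_area.
apply: le_trans aA _; rewrite lee_fin.
have mR : measurable (`[(Z m).1, (Z 0).1] `*` `[c, d] : set plane).
  by apply: measurableX; exact: measurable_itv.
(* By inclusion-exclusion the intersection has area at most [b1 + b2] minus the area of the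
   rectangle, which [trapezoid_sumE] bounds. *)
have := le_area mR (measurableU _ _ mB1 mB2) RB.
have cd : c <= d by lra.
rewrite area_rectangle// area_setU//; last by rewrite eb1 ltry.
rewrite eb1 eb2 ei -!EFinD lee_fin => leR.
by move: leR lb1 lb2 (trapezoid_sumE c d); lra.
Qed.

(* The trapezoids above the upper chain and those below the lower chain cover
   the complement of [A] in the rectangle. *)
Lemma area_ge_chain A : measurable A -> convex_set A ->
  (forall k, A (Z k)) -> (trapezoid_sum%:E <= area A)%E.
Proof.
move=> mA cA AZ.
have [c [d [cM Md Zcd]]] := bounds (lexx 0).
pose B1 := \big[setU/set0]_(k < m) trap_above d (Z k.+1) (Z k).
pose B2 := \big[setU/set0]_(k < m) trap_below c (Z (m + k).+1) (Z (m + k)%N).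
have mB1 : measurable B1.
  by apply: bigsetU_measurable => k _; exact: measurable_trap_above.
have mB2 : measurable B2.
  by apply: bigsetU_measurable => k _; exact: measurable_trap_below.
have B1P k p : (k < m)%N -> trap_above d (Z k.+1) (Z k) p -> B1 p.
  move=> km Tp; rewrite /B1 -(bigcup_mkord _ (fun k => trap_above d (Z k.+1) (Z k))).
  by exists k.
have B2P k p : (k < m)%N -> trap_below c (Z (m + k).+1) (Z (m + k)%N) p -> B2 p.
  move=> km Tp.
  rewrite /B2 -(bigcup_mkord _ (fun k => trap_below c (Z (m + k).+1) (Z (m + k)%N))).
  by exists k.
have aB1 : (area B1 <= (\sum_(k < m) ((Z k).1 - (Z k.+1).1) *
    (d - ((Z k).2 + (Z k.+1).2) / 2))%:E)%E.
  apply: (@area_bigcup_le _ (fun k => trap_above d (Z k.+1) (Z k))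
    (fun k => ((Z k).1 - (Z k.+1).1) * (d - ((Z k).2 + (Z k.+1).2) / 2))).
  move=> k km; split; first exact: measurable_trap_above.
  have /andP[_ c1] : c <= (Z k).2 <= d by apply: Zcd; lia.
  have /andP[_ c2] : c <= (Z k.+1).2 <= d by apply: Zcd; lia.
  by apply: area_trap_above => //; exact: Zl.
have aB2 : (area B2 <= (\sum_(k < m) ((Z (m + k).+1).1 - (Z (m + k)).1) *
     (((Z (m + k).+1).2 + (Z (m + k)).2) / 2 - c))%:E)%E.
  apply: (@area_bigcup_le _ (fun k => trap_below c (Z (m + k).+1) (Z (m + k)%N))
    (fun k => ((Z (m + k).+1).1 - (Z (m + k)).1) *
     (((Z (m + k).+1).2 + (Z (m + k)).2) / 2 - c))).
  move=> k km; split; first exact: measurable_trap_below.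
  have /andP[c1 _] : c <= (Z (m + k)).2 <= d by apply: Zcd; lia.
  have /andP[c2 _] : c <= (Z (m + k).+1).2 <= d by apply: Zcd; lia.
  by apply: area_trap_below => //; apply: Zr; lia.
have [b1 eb1 lb1] := area_bounded_fin aB1.
have [b2 eb2 lb2] := area_bounded_fin aB2.
have RB : `[(Z m).1, (Z 0).1] `*` `[c, d] `<=` A `|` (B1 `|` B2).
  move=> [x y] [] /=; rewrite !in_itv/= => xZ /andP[cy yd].
  (* A point of the rectangle outside all trapezoids is strictly below an upper chord and strictly
     above a lower one, hence between two points of [A] on the same vertical line. *)
  apply: contrapT => /not_orP[nA /not_orP[nB1 nB2]]; apply: nA.
  have [k km /andP[h1 h2]] := topcell xZ.
  have [j jm /andP[h3 h4]] := botcell xZ.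
  have top : 0 < det2 (Z k.+1 - Z k) ((x, y) - Z k).
    rewrite ltNge; apply/negP => le; apply: nB1; apply: (B1P k) => //.
    by split => //=; move: le; rewrite /det2 /=; lra.
  have bot : 0 < det2 (Z (m + j).+1 - Z (m + j)) ((x, y) - Z (m + j)).
    rewrite ltNge; apply/negP => le; apply: nB2; apply: (B2P j) => //.
    by split => //=; move: le; rewrite /det2 /=; lra.
  have [yt Ayt lyt] : exists2 yt, A (x, yt) & y < yt.
    apply: (segment_above (AZ k) (AZ k.+1) cA); first by rewrite h1 h2.
    by move: top; rewrite /det2 /=; lra.
  have [yb Ayb lyb] : exists2 yb, A (x, yb) & yb < y.
    apply: (segment_below (AZ (m + j)%N) (AZ (m + j).+1) cA).
      by rewrite h3 h4.
    by move: bot; rewrite /det2 /=; lra.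
  have D0 : 0 < yt - yb by lra.
  have := @convex_comb _ A _ _ ((y - yb) / (yt - yb)) cA Ayt Ayb.
  rewrite !pairZ /= ler_pdivlMr// mul0r ler_pdivrMr// mul1r => h.
  have -> : (x, y) = ((y - yb) / (yt - yb) * x, (y - yb) / (yt - yb) * yt) +
      ((1 - (y - yb) / (yt - yb)) * x, (1 - (y - yb) / (yt - yb)) * yb).
    by congr pair => /=; field; rewrite gt_eqF.
  by apply: h; apply/andP; split; lra.
have mR : measurable (`[(Z m).1, (Z 0).1] `*` `[c, d] : set plane).
  by apply: measurableX; exact: measurable_itv.
have := le_area mR (measurableU _ _ mA (measurableU _ _ mB1 mB2)) RB.
have cd : c <= d by lra.
rewrite area_rectangle// => leR.
have {leR} := le_trans leR (area_setU_le mA (measurableU _ _ mB1 mB2)).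
move=> /le_trans/(_ (leeD2l _ (area_setU_le mB1 mB2))).
rewrite eb1 eb2; case: (area A) (area_ge0 A) => [r _|_ _|//]; last by rewrite leey.
rewrite -!EFinD !lee_fin => le.
have := trapezoid_sumE d c.
rewrite (_ : \sum_(k < m) _ = - \sum_(k < m) ((Z k).1 - (Z k.+1).1) *
    (d - ((Z k).2 + (Z k.+1).2) / 2)); last first.
  by rewrite -sumrN; apply: eq_bigr => k _; ring.
rewrite (_ : \sum_(k < m) ((Z (m + k).+1).1 - (Z (m + k)).1) *
     (c - ((Z (m + k).+1).2 + (Z (m + k)).2) / 2) =
   - \sum_(k < m) ((Z (m + k).+1).1 - (Z (m + k)).1) *
     (((Z (m + k).+1).2 + (Z (m + k)).2) / 2 - c)); last first.
  by rewrite -sumrN; apply: eq_bigr => k _; ring.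
by lra.
Qed.

End ChainArea.

(** * Area from the support function *)

Section AreaBounds.
Context {R : realType}.
Local Notation plane := (R * R)%type.
Local Notation area := (@area R).
Implicit Types (A : set plane) (x : plane -> plane) (u y z p : plane).

(** Term by term the two forms of the shoelace formula differ by [g (Z k) - g (Z k.+1)], which
    telescopes around the closed chain. *)
Lemma trapezoid_sum_det2 m (Z : nat -> plane) : Z m.*2 = Z 0%N ->
  trapezoid_sum m Z = 2^-1 * \sum_(k < m.*2) det2 (Z k) (Z k.+1).
Proof.
move=> Zc; pose g (p : plane) := p.1 * p.2 / 2.
have tel n : \sum_(k < n) (g (Z k) - g (Z k.+1)) = g (Z 0%N) - g (Z n).
  by elim: n => [|n IH]; rewrite ?big_ord0 ?subrr// big_ord_recr /= IH; ring.
rewrite -[LHS]subr0 -[X in _ - X](subrr (g (Z 0%N))) -[X in _ - (_ - g X)]Zc.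
rewrite -tel /trapezoid_sum big_distrr -sumrB.
by apply: eq_bigr => k _ /=; rewrite /g /det2; field.
Qed.

Lemma convex_section A z w (x : R) : convex_set A -> A z -> A w ->
  w.1 <= x <= z.1 -> exists t : R, A (x, t).
Proof.
move=> cA Az Aw xzw; have [e|ne] := eqVneq w.1 z.1.
  exists w.2; rewrite (_ : x = w.1) -?surjective_pairing//.
  by apply/eqP; rewrite eq_le andbC {2}e.
have D0 : 0 < z.1 - w.1.
  by move: xzw ne => /andP[h1 h2] ne; rewrite subr_gt0 lt_neqAle ne (le_trans h1 h2).
pose t := (x - w.1) / (z.1 - w.1).
exists (t * z.2 + (1 - t) * w.2).
have -> : (x, t * z.2 + (1 - t) * w.2) = t *: z + (1 - t) *: w.
  by rewrite !pairZ /t; congr pair => /=; field; rewrite gt_eqF.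
apply: convex_comb => //; rewrite /t ler_pdivlMr// mul0r ler_pdivrMr// mul1r.
by move: xzw => /andP[h1 h2]; apply/andP; split; lra.
Qed.

Variables (A : set plane) (x : plane -> plane) (m : nat).
Hypothesis hx : contact A x.
Hypothesis m2 : (2 <= m)%N.

Let q : R := hsin m.
Let r : R := hcos m.
Let c : R := 1 - 2 * q ^+ 2.
Let s : R := 2 * q * r.
Let u k := dir m k : plane.

Definition supp k : R := dot (x (dir m k)) (dir m k).
(* The edge with normal [dir m k.+1] of the polygon circumscribed along the
   directions [dir m _] has length [curv k / sin (pi / m)]. *)
Definition curv k : R :=
  supp k + supp k.+2 - 2 * (1 - 2 * hsin m ^+ 2) * supp k.+1.

Let q0 : 0 < q. Proof. exact: hsin_gt0. Qed.
Let r0 : 0 < r. Proof. exact: hcos_gt0. Qed.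
Let s0 : 0 < s. Proof. by rewrite /s mulr_gt0// mulr_gt0. Qed.
Let cs1 : c ^+ 2 + s ^+ 2 = 1.
Proof.
have := hcos2Dhsin2 (R := R) m; rewrite -/q -/r => qr.
have r2 : r ^+ 2 = 1 - q ^+ 2 by rewrite -qr addrK.
by rewrite /c /s; ring: r2.
Qed.
Let uS k : u k.+1 = c *: u k + s *: perp (u k).
Proof. exact: dirS. Qed.
Let u1 k : (u k).1 ^+ 2 = 1 - (u k).2 ^+ 2.
Proof. by rewrite -(dir_norm (R := R) m k) addrK. Qed.
Let m_gt0 : (0 < m)%N. Proof. exact: ltnW. Qed.

Lemma suppD2m k : supp (k + m.*2) = supp k.
Proof. by rewrite /supp dirD2m. Qed.

Let uP k : c *: u k.+1 - s *: perp (u k.+1) = u k.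
Proof.
have c2 : c ^+ 2 = 1 - s ^+ 2 by rewrite -cs1 addrK.
rewrite uS; move: (u k) => v; rewrite !pairZ /perp.
by rewrite [RHS]surjective_pairing; congr pair => /=; ring: c2.
Qed.

(** The contact point of the middle direction obeys the two neighbouring support inequalities, and
    [u k + u k.+2] is [2 * c] times [u k.+1]. *)
Lemma curv_ge0 k : 0 <= curv k.
Proof.
have Ax := (hx (u k.+1)).1.
have h1 : dot (x (u k.+1)) (u k) <= supp k by exact: (hx _).2.
have h2 : dot (x (u k.+1)) (u k.+2) <= supp k.+2 by exact: (hx _).2.
have e : dot (x (u k.+1)) (u k) + dot (x (u k.+1)) (u k.+2) = 2 * c * supp k.+1.
  by rewrite -(uP k) (uS k.+1) !(dotDr, dotNr, dotZr) /supp -/(u k.+1); ring.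
by rewrite /curv -/q -/c -e; lra.
Qed.

(* The intersection of the support lines with normals [dir m k] and
   [dir m k.+1]. *)
Definition vertex k : plane :=
  supp k *: dir m k + ((supp k.+1 - (1 - 2 * hsin m ^+ 2) * supp k) /
    (2 * hsin m * hcos m)) *: perp (dir m k).

Let dot_perp (v : plane) : dot (perp v) v = 0.
Proof. by rewrite /dot /perp /=; ring. Qed.
Let dot_u k : dot (u k) (u k) = 1. Proof. exact: dot_dir_dir. Qed.
Let dot_perpS k : dot (perp (u k)) (u k.+1) = s.
Proof.
rewrite uS !(dotDr, dotZr) dot_perp mulr0 add0r.
have -> : dot (perp (u k)) (perp (u k)) = dot (u k) (u k).
  by move: (u k) => v; rewrite /dot /perp /=; ring.
by rewrite dot_u mulr1.
Qed.
Let dot_uS k : dot (u k) (u k.+1) = c.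
Proof. by rewrite uS !(dotDr, dotZr) dot_u dotC dot_perp mulr0 addr0 mulr1. Qed.

Lemma dot_vertex k : dot (vertex k) (dir m k) = supp k.
Proof.
by rewrite /vertex !(dotDl, dotZl) dot_perp -/(u k) dot_u mulr0 addr0 mulr1.
Qed.

Lemma dot_vertexS k : dot (vertex k) (dir m k.+1) = supp k.+1.
Proof.
rewrite /vertex !(dotDl, dotZl) -/(u k) -/(u k.+1) dot_uS dot_perpS.
by rewrite -/q -/r -/c -/s divfK ?gt_eqF//; ring.
Qed.

Lemma vertexS k : vertex k.+1 =
  vertex k + (curv k / (2 * hsin m * hcos m)) *: perp (dir m k.+1).
Proof.
have c2 : c ^+ 2 = 1 - s ^+ 2 by rewrite -cs1 addrK.
rewrite /vertex /curv -/q -/r -/c -/s -/(u k) -/(u k.+1) -(uP k).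
move: (u k.+1) (supp k) (supp k.+1) (supp k.+2) => v a b d.
rewrite !pairZ /perp; congr pair => /=.
  by field: c2; rewrite gt_eqF.
by field: c2; rewrite gt_eqF.
Qed.

Let sin_ge0 k : (k <= m)%N -> 0 <= (u k).2.
Proof. by move=> km; apply: sin_dir_ge0. Qed.

Let sin_le0 k : (m <= k <= m.*2)%N -> (u k).2 <= 0.
Proof.
move=> km; have -> : k = ((k - m) + m)%N by lia.
by rewrite /u dirDm// oppr_le0; apply: sin_ge0; lia.
Qed.

(** The bound is the area of the circumscribed polygon, cut into signed triangles with apex at the
    origin: the height is [supp k.+1], the base is the edge length. *)
Lemma area_le_supp : measurable A -> convex_set A ->
  (area A <= (2^-1 * \sum_(k < m.*2) (supp k.+1 * (curv k / (2 * hsin m * hcos m))))%:E)%E.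
Proof.
rewrite -/q -/r -/s => mA cA.
have vc : vertex m.*2 = vertex 0.
  by rewrite /vertex -[m.*2]add0n -addSn !suppD2m dirD2m.
have v0 : (vertex 0).1 = supp 0.
  by rewrite -dot_vertex dir0; move: (vertex 0) => p; rewrite /dot /=; ring.
have um : dir m m = (- 1, 0) :> plane.
  by rewrite -[X in dir m X]add0n dirDm// dir0; congr pair; rewrite /= oppr0.
have vm : (vertex m).1 = - supp m.
  by rewrite -dot_vertex um; move: (vertex m) => p; rewrite /dot /=; ring.
rewrite (_ : 2^-1 * _ = trapezoid_sum m vertex); last first.
  rewrite trapezoid_sum_det2//; congr (_ * _); apply: eq_bigr => k _.
  rewrite vertexS -/q -/r -/s -dot_vertexS; move: (vertex k) (dir m k.+1) (curv k / s).
  by move=> p v t; rewrite !pairZ /det2 /dot /perp /=; ring.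
have tk k : 0 <= curv k / s by rewrite divr_ge0 ?curv_ge0// ltW.
apply: (@area_le_chain _ m vertex m_gt0 _ _ vc _
  (`|dot (x (0, 1)) (0, 1)| + `|dot (x (0, - 1)) (0, - 1)|)) => //.
- move=> k km; rewrite vertexS -/q -/r -/s -/(u k.+1) pairZ /=.
  by rewrite gerDl mulrN oppr_le0 mulr_ge0// sin_ge0.
- move=> k km; rewrite vertexS -/q -/r -/s -/(u k.+1) pairZ /=.
  by rewrite lerDl mulr_ge0// oppr_ge0 sin_le0//; lia.
- move=> p Ap; have := (hx (0, 1)).2 _ Ap; have := (hx (0, - 1)).2 _ Ap.
  move: (dot (x (0, 1)) _) (dot (x (0, - 1)) _) => a b.
  rewrite /dot /= !mulr0 !add0r mulrN !mulr1 => h1 h2.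
  have := ler_norm a; have := ler_norm b; have := normr_ge0 a; have := normr_ge0 b.
  by move=> *; rewrite ler_norml; apply/andP; split; lra.
- move=> p Ap; rewrite v0 vm; apply/andP; split.
    have := (hx (dir m m)).2 _ Ap; rewrite -/(supp m) um.
    by rewrite /dot /=; lra.
  have := (hx (dir m 0)).2 _ Ap; rewrite -/(supp 0) dir0.
  by rewrite /dot /=; lra.
- move=> t tP; apply: (@convex_section _ (x (dir m 0)) (x (dir m m)) t cA).
  + exact: (hx _).1.
  + exact: (hx _).1.
  + move: tP; rewrite v0 vm.
    rewrite /supp um dir0 /dot /=.
    rewrite mulr1 !mulr0 !addr0 mulrN mulr1 opprK.
    by rewrite -um -(dir0 (R := R) m).
- move=> k p km Ap; rewrite vertexS -/q -/r -/s.
  have := (hx (dir m k.+1)).2 _ Ap; rewrite -/(supp k.+1) -dot_vertexS.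
  move: (vertex k) (dir m k.+1) (curv k / s) (tk k) => z v t t0.
  rewrite -subr_ge0 => h.
  rewrite (_ : det2 _ _ = t * (dot z v - dot p v)) ?mulr_ge0//.
  by rewrite !pairZ /det2 /dot /perp /=; ring.
Qed.

(* The contact point [x (u k)] splits the edge on which it lies into parts of
   lengths [be k.-1] and [al k]; each corner cut off at [vertex k] has area
   [s * al k * be k / 2]. *)
Lemma area_ge_supp : measurable A -> convex_set A ->
  ((2^-1 * (\sum_(k < m.*2) (supp k.+1 * (curv k / (2 * hsin m * hcos m))) -
    (2 * hsin m * hcos m) *
      (\sum_(k < m.*2) curv k / (2 * hsin m * hcos m)) ^+ 2))%:E
   <= area A)%E.
Proof.
rewrite -/q -/r -/s => mA cA.
pose sg k := dot (x (u k)) (perp (u k)).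
pose al k := (supp k.+1 - c * supp k) / s - sg k.
pose be k := sg k.+1 + (supp k - c * supp k.+1) / s.
have sn0 : s != 0 by rewrite gt_eqF.
have albe k : al k.+1 + be k = curv k / s.
  by rewrite /al /be /curv -/q -/c; field.
have xE k : x (u k) = supp k *: u k + sg k *: perp (u k).
  rewrite /sg /supp -/(u k); move: (x (u k)) (u k) (u1 k) => p v v1.
  rewrite !pairZ /perp /dot [LHS]surjective_pairing; congr pair => /=; ring: v1.
have xal k : x (u k) = vertex k - al k *: perp (u k).
  rewrite {1}xE /vertex -/q -/r -/c -/s -/(u k) /al.
  by move: (u k) => v; rewrite !pairZ; congr pair => /=; field.
have xbe k : x (u k.+1) = vertex k + be k *: perp (u k.+1).
  have -> : vertex k = vertex k.+1 - (curv k / s) *: perp (u k.+1).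
    by rewrite vertexS -/q -/r -/s -/(u k.+1) addrK.
  rewrite {1}xE /vertex -/q -/r -/c -/s -/(u k.+1) /be /curv -/q -/c.
  by move: (u k.+1) => v; rewrite !pairZ; congr pair => /=; field.
have al0 k : 0 <= al k.
  have : dot (x (u k)) (u k.+1) <= supp k.+1 by exact: (hx _).2 _ (hx _).1.
  rewrite uS !(dotDr, dotZr) -/(sg k) => h.
  by rewrite /al subr_ge0 ler_pdivlMr//; move: h; rewrite /supp -/(u k); lra.
have be0 k : 0 <= be k.
  have : dot (x (u k.+1)) (u k) <= supp k by exact: (hx _).2 _ (hx _).1.
  rewrite -(uP k) !(dotDr, dotNr, dotZr) -/(sg k.+1) => h.
  rewrite /be -lerBlDr sub0r -mulNr ler_pdivrMr//.
  by move: h; rewrite /supp -/(u k.+1); lra.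
pose Z k := x (dir m k).
have Zc : Z m.*2 = Z 0 by rewrite /Z -[m.*2]add0n dirD2m.
have detE k : det2 (Z k) (Z k.+1) =
    supp k * al k + supp k.+1 * be k - s * (al k * be k).
  rewrite /Z -/(u k) -/(u k.+1) xal xbe.
  rewrite -(dot_vertex k) -(dot_vertexS k) -/(u k) -/(u k.+1) -(dot_perpS k).
  move: (vertex k) (u k) (u k.+1) (al k) (be k) => p v w a b.
  by rewrite !pairZ /det2 /dot /perp /=; ring.
have sumE : \sum_(k < m.*2) det2 (Z k) (Z k.+1) =
    \sum_(k < m.*2) (supp k.+1 * (curv k / s)) -
    s * \sum_(k < m.*2) (al k * be k).
  have alD k : al (k + m.*2) = al k.
    by rewrite /al /sg /u -addSn !suppD2m dirD2m.
  have sh : \sum_(k < m.*2) supp k * al k = \sum_(k < m.*2) supp k.+1 * al k.+1.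
    rewrite -(@sum_shift _ (fun k => supp k * al k) m.*2 1).
      by apply: eq_bigr => k _; rewrite addn1.
    by move=> k; rewrite suppD2m alD.
  rewrite (eq_bigr _ (fun (k : 'I_m.*2) _ => detE k)) sumrB big_split /= sh.
  congr (_ - _); last by rewrite big_distrr.
  rewrite -big_split /=.
  by apply: eq_bigr => k _; rewrite -albe [RHS]mulrDr.
(* Crude but sufficient: the total edge length stays bounded as [m] grows, while the factor [s] in
   front tends to 0. *)
have sumab : \sum_(k < m.*2) (al k * be k) <= (\sum_(k < m.*2) curv k / s) ^+ 2.
  have cb k : al k.+1 <= curv k / s by rewrite -albe lerDl.
  have sa : \sum_(k < m.*2) al k <= \sum_(k < m.*2) curv k / s.
    rewrite -(@sum_shift _ al m.*2 1); last first.
      by move=> k; rewrite /al /sg /u -addSn !suppD2m dirD2m.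
    by apply: ler_sum => k _; rewrite addn1.
  have sb (k : 'I_m.*2) : be k <= \sum_(k < m.*2) curv k / s.
    apply: (@le_trans _ _ (curv k / s)); first by rewrite -albe lerDr.
    rewrite (bigD1 k)//= lerDl sumr_ge0// => i _.
    by rewrite divr_ge0 ?curv_ge0// ltW.
  apply: (@le_trans _ _ (\sum_(k < m.*2) al k * \sum_(k < m.*2) curv k / s)).
    by apply: ler_sum => k _; rewrite ler_wpM2l.
  rewrite -big_distrl /= expr2 ler_wpM2r// sumr_ge0// => i _.
  by rewrite divr_ge0 ?curv_ge0// ltW.
apply: (@le_trans _ _ (trapezoid_sum m Z)%:E); last first.
  apply: area_ge_chain => //; last by move=> k; exact: (hx _).1.
  - move=> k km; rewrite /Z -/(u k) -/(u k.+1) xbe xal.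
    have := mulr_ge0 (al0 k) (sin_ge0 (ltnW km)).
    have := mulr_ge0 (be0 k) (sin_ge0 km).
    move: (vertex k) (u k) (u k.+1) (al k) (be k) => p v w a b.
    by rewrite !pairZ /=; lra.
  - move=> k km; rewrite /Z -/(u k) -/(u k.+1) xbe xal.
    have km1 : (m <= k <= m.*2)%N by lia.
    have km2 : (m <= k.+1 <= m.*2)%N by lia.
    have := mulr_ge0_le0 (al0 k) (sin_le0 km1).
    have := mulr_ge0_le0 (be0 k) (sin_le0 km2).
    move: (vertex k) (u k) (u k.+1) (al k) (be k) => p v w a b.
    by rewrite !pairZ /=; lra.
rewrite lee_fin trapezoid_sum_det2// sumE ler_pM2l ?invr_gt0// lerD2l lerN2.
by rewrite ler_pM2l.
Qed.

End AreaBounds.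

(** * Constant width and the symmetric hull *)

Section ConstantWidth.
Context {R : realType}.
Local Notation plane := (R * R)%type.
Implicit Types (A K : set plane) (x : plane -> plane) (u y z : plane).

Lemma compact_contact A : compact A -> A !=set0 -> exists x, contact A x.
Proof.
move=> cA A0.
have /choice[x hx] : forall u, exists z, A z /\ forall y, A y -> dot y u <= dot z u.
  move=> u; have [z Az zmax] := @compact_EVT_max _ _ (fun z => dot z u) A A0 cA
    (continuous_subspaceT (@continuous_dot _ u)).
  by exists z; split; [exact: set_mem|move=> y Ay; apply: zmax; exact: mem_set].
by exists x.
Qed.

Lemma set_dist_lines u (c d : R) : dot u u = 1 -> d <= c ->
  set_dist (line u c) (line u d) = c - d.
Proof.
move=> u1 dc; rewrite /set_dist; set E := (X in inf X).
have Ecd : E (c - d).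
  exists (c *: u); first by rewrite /line/= dotZr u1 mulr1.
  exists (d *: u); first by rewrite /line/= dotZr u1 mulr1.
  by rewrite -scalerBl /enorm dotZl dotZr u1 mulr1 -expr2 sqrtr_sqr ger0_norm// subr_ge0.
have lbE : lbound E (c - d).
  move=> _ [a /= ac [b /= bd <-]]; rewrite -ac -bd ![dot u _]dotC -dotBl.
  by apply: le_trans (ler_norm _) _; exact: dot_le_enorm.
apply/eqP; rewrite eq_le; apply/andP; split.
  by apply: ge_inf => //; exists (c - d).
by apply: lb_le_inf => //; exists (c - d).
Qed.

(** Constant width speaks of distinct lines only. Moving an interior point along [u] inside [K]
    shows that the two support lines normal to [u] are distinct. *)
Lemma constant_width_contact K x w u : constant_width K w -> K° !=set0 ->
  contact K x -> dot u u = 1 -> width x u = w.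
Proof.
move=> cw [z Kz] hx u1.
have u0 : u != 0.
  by apply/eqP => e; move/eqP: u1; rewrite e /dot/= !mul0r addr0 eq_sym oner_eq0.
have lt : dot (x (- u)) u < dot (x u) u.
  have [t t0 Kt] := interior_shift u Kz.
  have h1 := (hx u).2 _ Kt.
  have h2 := (hx (- u)).2 _ (interior_subset Kz).
  by move: h1 h2; rewrite dotDl dotZl u1 !dotNr mulr1; lra.
rewrite -(cw u (dot (x u) u) (dot (x (- u)) u)) //.
- by rewrite set_dist_lines// ?(ltW lt)// /width dotNr.
- split; first by exists (x u); split; [exact: dotC|exact: (hx u).1].
  by left => y Ky /=; rewrite dotC; exact: (hx u).2.
- split; first by exists (x (- u)); split; [exact: dotC|exact: (hx (- u)).1].
  by right => y Ky /=; rewrite [leRHS]dotC -lerN2 -!dotNr; exact: (hx (- u)).2.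
- move=> e; have : line u (dot (x u) u) (x u) by exact: dotC.
  by rewrite e /line /= dotC => ee; move: lt; rewrite ee ltxx.
Qed.

Lemma convex_cone_comb A (p q : R) z y : convex_set A -> A z -> A y ->
  0 <= p -> 0 <= q -> exists2 v, A v & p *: z + q *: y = (p + q) *: v.
Proof.
move=> cA Az Ay p0 q0; have [e|ne] := eqVneq (p + q) 0.
  have [-> ->] : p = 0 /\ q = 0 by split; lra.
  by exists z => //; rewrite !scale0r !addr0 scale0r.
have pq : 0 < p + q by rewrite lt_neqAle eq_sym ne addr_ge0.
exists ((p / (p + q)) *: z + (1 - p / (p + q)) *: y).
  apply: convex_comb => //; rewrite ler_pdivlMr// mul0r ler_pdivrMr// mul1r.
  by rewrite p0 lerDl.
by rewrite !pairZ; congr pair => /=; field.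
Qed.

(** For convex [K] one parameter and one point from each of [K] and [-K] suffice, so the hull is a
    continuous image of a product, compact when [K] is. *)
Definition hull_point (v : R * (plane * plane)) : plane :=
  v.1 *: v.2.1 - (1 - v.1) *: v.2.2.

Lemma symm_hullE K : convex_set K -> K !=set0 ->
  symm_hull K = hull_point @` (`[0, 1] `*` (K `*` K)).
Proof.
move=> cK [k0 Kk0]; apply/seteqP; split.
  apply: smallest_sub.
    move=> y z l; rewrite !inE => -[[t [a b]] [/= t01 [/= Ka Kb]] <-].
    move=> [[t' [a' b']] [/= t'01 [/= Ka' Kb']] <-].
    have l0 : 0 <= l%:num by [].
    have l1 : 0 <= 1 - l%:num by rewrite subr_ge0.
    move: t01 t'01; rewrite !in_itv/= => /andP[t0 t1] /andP[t'0 t'1].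
    have [p0 q0] : 0 <= l%:num * t /\ 0 <= (1 - l%:num) * t'.
      by split; rewrite mulr_ge0.
    have [p1 q1] : 0 <= l%:num * (1 - t) /\ 0 <= (1 - l%:num) * (1 - t').
      by split; rewrite mulr_ge0// subr_ge0.
    have [v Kv ev] := convex_cone_comb cK Ka Ka' p0 q0.
    have [w Kw ew] := convex_cone_comb cK Kb Kb' p1 q1.
    exists (l%:num * t + (1 - l%:num) * t', (v, w)); rewrite /hull_point /=.
      split=> /=; last by split.
      by rewrite in_itv/=; move: p0 q0 p1 q1; move: (l%:num) => L *;
        apply/andP; split; lra.
    have -> : 1 - (l%:num * t + (1 - l%:num) * t') =
      l%:num * (1 - t) + (1 - l%:num) * (1 - t') by ring.
    rewrite -ev -ew; transitivity (l%:num *: (t *: a - (1 - t) *: b) +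
      (1 - l%:num) *: (t' *: a' - (1 - t') *: b')); last by [].
    by rewrite !pairZ; congr pair => /=; ring.
  move=> y [Ky|[z Kz <-]].
    exists (1, (y, y)).
      split => /=; last by split.
      by rewrite in_itv/= lexx ler01.
    by rewrite /hull_point/= scale1r subrr scale0r subr0.
  exists (0, (z, z)).
    split => /=; last by split.
    by rewrite in_itv/= lexx ler01.
  by rewrite /hull_point/= scale0r subr0 scale1r sub0r.
move=> _ [[t [a b]] [/= t01 [/= Ka Kb]] <-] M [cM KM]; rewrite /hull_point /= -scalerN.
have Ma : M a by apply: KM; left.
have Mb : M (- b) by apply: KM; right; exists b.
by apply: convex_comb => //; move: t01; rewrite in_itv.
Qed.

Lemma closed_compact_plane A : compact A -> closed A.
Proof. by apply: compact_closed; exact: norm_hausdorff. Qed.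

Lemma symm_hull_compact K : convex_set K -> K !=set0 -> compact K ->
  compact (symm_hull K).
Proof.
move=> cK K0 cpK; rewrite symm_hullE//; apply: continuous_compact.
  apply: continuous_subspaceT => -[t [a b]]; apply: cvgB; apply: cvgZ.
  - exact: cvg_fst.
  - by apply: cvg_comp; [exact: cvg_snd|exact: cvg_fst].
  - by apply: cvgB; [exact: cvg_cst|exact: cvg_fst].
  - by apply: cvg_comp; [exact: cvg_snd|exact: cvg_snd].
by apply: compact_setX; [exact: segment_compact|exact: compact_setX].
Qed.

Lemma symm_hull_convex K : convex_set (symm_hull K).
Proof.
move=> y z l; rewrite !inE => Sy Sz M cM; apply/set_mem.
by apply: cM.1; apply: mem_set; [exact: Sy|exact: Sz].
Qed.

Definition symm_contact x u : plane :=
  if dot (x (- u)) (- u) <= dot (x u) u then x u else - x (- u).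

Lemma symm_contactE x u : dot (symm_contact x u) u =
  Num.max (dot (x u) u) (dot (x (- u)) (- u)).
Proof.
rewrite /symm_contact; case: leP => [//|_]; by rewrite dotNl dotNr.
Qed.

Lemma symm_hull_contact K x : convex_set K -> K !=set0 -> contact K x ->
  contact (symm_hull K) (symm_contact x).
Proof.
move=> cK K0 hx u; split.
  apply: sub_gen_smallest; rewrite /symm_contact; case: ifP => _.
    by left; exact: (hx u).1.
  by right; exists (x (- u)) => //; exact: (hx (- u)).1.
move=> y; rewrite symm_hullE// symm_contactE.
move=> [[t [a b]] [/= t01 [/= Ka Kb]] <-]; rewrite /hull_point /= dotBl !dotZl.
move: t01; rewrite in_itv/= => /andP[t0 t1].
have h1 := (hx u).2 _ Ka; have h2 := (hx (- u)).2 _ Kb.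
set M := Num.max _ _.
have M1 : dot a u <= M by rewrite /M le_max h1.
have M2 : - dot b u <= M by rewrite -dotNr /M le_max h2 orbT.
have := ler_wpM2l t0 M1; have t1' : 0 <= 1 - t by rewrite subr_ge0.
by have := ler_wpM2l t1' M2; lra.
Qed.

End ConstantWidth.

(** * The quadratic form and the sign changes *)

Section QuadraticForm.
Context {R : realType}.
Variables (N : nat) (c : R).
Implicit Types f g : nat -> R.

(** With [c] the cosine of the step, this vanishes on sampled sinusoids and discretizes [f'' + f];
    [quad] then discretizes the integral of [f^2 - f'^2]. *)
Definition second_diff f k : R := f k + f k.+2 - 2 * c * f k.+1.
Definition quad f : R := \sum_(k < N) f k.+1 * second_diff f k.

Definition is_periodic f := forall k, f (k + N)%N = f k.

Lemma sum_shift1 f : is_periodic f -> \sum_(k < N) f k.+1 = \sum_(k < N) f k.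
Proof.
move=> fN; rewrite -(@sum_shift _ f N 1 fN).
by apply: eq_bigr => k _; rewrite addn1.
Qed.

Lemma sum_shift2 f : is_periodic f -> \sum_(k < N) f k.+2 = \sum_(k < N) f k.
Proof.
move=> fN; rewrite -(@sum_shift _ f N 2 fN).
by apply: eq_bigr => k _; rewrite addn2.
Qed.

Lemma sum_second_diff f : is_periodic f ->
  \sum_(k < N) second_diff f k = 2 * (1 - c) * \sum_(k < N) f k.
Proof.
move=> fN; rewrite /second_diff sumrB big_split /= -big_distrr /=.
by rewrite sum_shift1// sum_shift2//; ring.
Qed.

Lemma quad_shift f g : is_periodic g -> (forall k, f k = 2^-1 + g k) ->
  quad f = N%:R * (1 - c) / 2 + 2 * (1 - c) * (\sum_(k < N) g k) + quad g.
Proof.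
move=> gN fE; rewrite /quad.
transitivity (\sum_(k < N) ((1 - c) / 2 + (1 - c) * g k.+1 +
    2^-1 * second_diff g k + g k.+1 * second_diff g k)).
  by apply: eq_bigr => k _; rewrite /second_diff !fE; field.
rewrite !big_split /= -!big_distrr /= sum_shift1// sum_second_diff//.
by rewrite sumr_const card_ord -[_ *+ N]mulr_natl; field.
Qed.

(** The squares of [g] and of its absolute value agree, so only products of neighbours contribute;
    each of them occurs twice in a period. *)
Lemma quad_normB g : is_periodic g ->
  quad (fun k => `|g k|) - quad g =
  2 * \sum_(k < N) (`|g k * g k.+1| - g k * g k.+1).
Proof.
move=> gN; pose e k := `|g k * g k.+1| - g k * g k.+1.
have eN : is_periodic e by move=> k; rewrite /e -addSn !gN.
rewrite -/(e _) mulr2n mulrDl mul1r.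
rewrite -[X in _ = _ + X](sum_shift1 eN) -big_split /quad -sumrB.
apply: eq_bigr => k _ /=; rewrite /e /second_diff !normrM.
have n2 := real_normK (num_real (g k.+1)).
by ring: n2.
Qed.

Lemma quad_norm_ge g : is_periodic g -> 0 <= quad (fun k => `|g k|) - quad g.
Proof.
move=> gN; rewrite quad_normB// mulr_ge0// sumr_ge0// => k _.
by rewrite subr_ge0 ler_norm.
Qed.

Definition sgn_ge0 (t : R) : R := if 0 <= t then 1 else - 1.

(** Only opposite signs matter. Then the left side is [- 4 a b], at most [(b - a)^2] because
    [(a + b)^2] is nonnegative, and one factor [b - a] is bounded by [L]. *)
Lemma norm_mul_sub_le (a b L : R) : `|b - a| <= L ->
  2 * (`|a * b| - a * b) <= L / 2 * ((sgn_ge0 b - sgn_ge0 a) * (b - a)).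
Proof.
rewrite /sgn_ge0 => baL; have [a0|a0] := leP 0 a; have [b0|b0] := leP 0 b.
- by rewrite ger0_norm ?mulr_ge0// !subrr mul0r !mulr0.
- rewrite ler0_norm ?mulr_ge0_le0 ?(ltW b0)//.
  have : - (b - a) <= L by apply: le_trans baL; rewrite -normrN ler_norm.
  move=> h; have : 0 <= (L + (b - a)) * (a - b) by rewrite mulr_ge0//; lra.
  by have := sqr_ge0 (a + b); rewrite !expr2; lra.
- rewrite ler0_norm ?mulr_le0_ge0 ?(ltW a0)//.
  have h : b - a <= L by apply: le_trans baL; rewrite ler_norm.
  have : 0 <= (L - (b - a)) * (b - a) by rewrite mulr_ge0//; lra.
  by have := sqr_ge0 (a + b); rewrite !expr2; lra.
- by rewrite ger0_norm ?mulr_le0 ?(ltW a0) ?(ltW b0)// !subrr mul0r !mulr0.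
Qed.

(* Summation by parts: the jumps of the sign of [g] are paired with the first
   differences of [g], whose total variation is governed by [second_diff]. *)
Lemma quad_norm_le g (L D : R) : is_periodic g ->
  (forall k, `|g k.+1 - g k| <= L) ->
  (forall k, `|g k.+2 - 2 * g k.+1 + g k| <= D) ->
  quad (fun k => `|g k|) - quad g <= L / 2 * (N%:R * D).
Proof.
move=> gN gL gD; rewrite quad_normB// big_distrr /=.
pose sg k := sgn_ge0 (g k); pose d k := g k.+1 - g k.
have L0 : 0 <= L by apply: le_trans (gL 0%N).
apply: (@le_trans _ _ (\sum_(k < N) L / 2 * ((sg k.+1 - sg k) * d k))).
  by apply: ler_sum => k _; exact: norm_mul_sub_le.
rewrite -big_distrr /= ler_wpM2l ?divr_ge0//.
have pN : is_periodic (fun k => sg k * d k).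
  by move=> k; rewrite /sg /d -addSn !gN.
have -> : \sum_(k < N) (sg k.+1 - sg k) * d k =
    \sum_(k < N) - sg k.+1 * (d k.+1 - d k).
  transitivity (\sum_(k < N) sg k.+1 * d k - \sum_(k < N) sg k * d k).
    by rewrite -sumrB; apply: eq_bigr => k _; ring.
  rewrite -(sum_shift1 pN) -sumrB; apply: eq_bigr => k _; ring.
rewrite -[N in N%:R](card_ord N) mulr_natl -sumr_const; apply: ler_sum => k _.
have := gD k; rewrite ler_norml => /andP[h1 h2].
by rewrite /sg /sgn_ge0 /d; case: ifP => _; lra.
Qed.

End QuadraticForm.

(** Here [G] stands for the sum of the absolute values of [g], and its linear contributions to [P]
    and [2 * aS] cancel. The four terms of the constant bound, in order, the corners cut from the
    hull, the sign changes, the corners cut from [K], and the error of the perimeter. *)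
Lemma gap_estimate (R : realFieldType) (q r N B P G Qg Qn aK aS : R) :
  0 < q -> q <= 2^-1 -> 0 < r -> r ^+ 2 = 1 - q ^+ 2 -> 0 <= N -> 0 <= B ->
  0 <= G -> G <= N * (B + 2^-1) ->
  Qg <= Qn -> Qn - Qg <= 8 * q ^+ 3 * N * (B * (1 + B)) ->
  2 * aK <= (N * q ^+ 2 + Qg) / (2 * q * r) ->
  (N * q ^+ 2 + Qg) / (2 * q * r) -
    2 * q * r * (4 * q ^+ 2 * (N / 2) / (2 * q * r)) ^+ 2 <= 2 * aK ->
  2 * aS <= (N * q ^+ 2 + 4 * q ^+ 2 * G + Qn) / (2 * q * r) ->
  (N * q ^+ 2 + 4 * q ^+ 2 * G + Qn) / (2 * q * r) -
    2 * q * r * (4 * q ^+ 2 * (N / 2 + G) / (2 * q * r)) ^+ 2 <= 2 * aS ->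
  2 * q * (N / 2 + G) <= P -> P * r <= 2 * q * (N / 2 + G) ->
  `|2 * aK - 2 * aS + P - N * q / r| <=
  (16 * (P * (1 + B)) ^+ 2 + 8 * P * (B * (1 + B)) + 4 * P ^+ 2 +
    2 * P * (1 + B)) * q.
Proof.
move=> q0 qh r0 r2 N0 B0 G0 GN leQ leE uK lK uS lS lP uP.
have rn0 : r != 0 by rewrite gt_eqF.
have qn0 : q != 0 by rewrite gt_eqF.
have r1 : r <= 1 by nra.
(* The assumption [q <= 2^-1] keeps [r] away from 0, so that [i = 1 / r] is at most 2. *)
have rh : 2^-1 <= r by nra.
pose i := r^-1; have ri : r * i = 1 by rewrite divff.
have i0 : 0 < i by rewrite invr_gt0.
have i2 : i <= 2 by rewrite -[2]invrK lef_pV2// posrE// invr_gt0.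
have i1 : 1 <= i by rewrite -invr1 lef_pV2// posrE.
pose eg := Qg / (2 * q); pose en := Qn / (2 * q).
have le_e : eg <= en by rewrite ler_pM2r// invr_gt0 mulr_gt0.
have e_le : en - eg <= 4 * q ^+ 2 * N * (B * (1 + B)).
  rewrite /en /eg -mulrBl ler_pdivrMr ?mulr_gt0//.
  by apply: le_trans leE _; rewrite le_eqVlt; apply/orP; left; apply/eqP; ring.
have [X0 XP] : 0 <= N * q /\ N * q <= P.
  split; first by rewrite mulr_ge0// ltW.
  by apply: le_trans lP; have := mulr_ge0 (ltW q0) G0; lra.
set Hs := N / 2 + G in lS lP uP *.
have Hs0 : 0 <= Hs by rewrite /Hs addr_ge0// divr_ge0.
have HsN : q * Hs <= P * (1 + B).
  apply: (@le_trans _ _ (N * q * (1 + B))); last by rewrite ler_wpM2r// addr_ge0.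
  rewrite [N * q]mulrC -mulrA ler_pM2l//.
  by rewrite /Hs; lra.
have P0 : 0 <= P by apply: le_trans XP.
rewrite (_ : (N * q ^+ 2 + Qg) / _ = i * (N * q / 2 + eg)) in uK lK; last first.
  by rewrite /i /eg; field; rewrite qn0 rn0.
rewrite (_ : (N * q ^+ 2 + 4 * q ^+ 2 * G + Qn) / _ =
    i * (N * q / 2 + 2 * q * G + en)) in uS lS; last first.
  by rewrite /i /en; field; rewrite qn0 rn0.
rewrite (_ : 2 * q * r * _ = i * (2 * q * (N * q) ^+ 2)) in lK; last first.
  by rewrite /i; field; rewrite qn0 rn0.
rewrite (_ : 2 * q * r * _ = i * (8 * q * (q * Hs) ^+ 2)) in lS; last first.
  by rewrite /i; field; rewrite qn0 rn0.
have uP' : P <= i * (2 * (q * Hs)).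
  rewrite /i mulrC ler_pdivlMr//; apply: le_trans uP _; lra.
have HsE : q * Hs = N * q / 2 + q * G by rewrite /Hs; ring.
have -> : N * q / r = i * (N * q) by rewrite mulrC.
have sq1 : (q * Hs) ^+ 2 <= (P * (1 + B)) ^+ 2.
  by rewrite ler_sqr ?nnegrE// ?mulr_ge0// ?addr_ge0// ltW.
have sq2 : (N * q) ^+ 2 <= P ^+ 2 by rewrite ler_sqr ?nnegrE.
have B1 : 0 <= 1 + B by rewrite addr_ge0.
have PB : 0 <= P * (1 + B) by rewrite mulr_ge0.
have PBB : 0 <= P * (B * (1 + B)) by rewrite !mulr_ge0.
have T1 : i * (8 * q * (q * Hs) ^+ 2) <= 16 * (P * (1 + B)) ^+ 2 * q.
  apply: (@le_trans _ _ (2 * (8 * q * (q * Hs) ^+ 2))).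
    by rewrite ler_wpM2r// !mulr_ge0 ?sqr_ge0// ltW.
  by have := ler_wpM2l (ltW q0) sq1; lra.
have T2 : i * (en - eg) <= 8 * P * (B * (1 + B)) * q.
  apply: (@le_trans _ _ (2 * (en - eg))); first by rewrite ler_wpM2r// subr_ge0.
  have h1 : q * (N * q) <= q * P by rewrite ler_pM2l.
  have := ler_wpM2r (mulr_ge0 B0 B1) h1.
  by move: e_le; rewrite expr2; lra.
have T3 : i * (2 * q * (N * q) ^+ 2) <= 4 * P ^+ 2 * q.
  apply: (@le_trans _ _ (2 * (2 * q * (N * q) ^+ 2))).
    by rewrite ler_wpM2r// !mulr_ge0 ?sqr_ge0// ltW.
  by have := ler_wpM2l (ltW q0) sq2; lra.
have iq : i - 1 <= q.
  have : i * (1 - r) <= 2 * (1 - r) by rewrite ler_wpM2r// subr_ge0.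
  rewrite mulrBr mulr1 [i * r]mulrC ri; nra.
have T4 : (i - 1) * (2 * (q * Hs)) <= 2 * P * (1 + B) * q.
  apply: (@le_trans _ _ (q * (2 * (q * Hs)))).
    by rewrite ler_wpM2r// !mulr_ge0// ltW.
  by have := ler_wpM2l (ltW q0) HsN; lra.
have p1 : 0 <= 16 * (P * (1 + B)) ^+ 2 * q by rewrite !mulr_ge0 ?sqr_ge0// ltW.
have p2 : 0 <= 8 * P * (B * (1 + B)) * q by rewrite !mulr_ge0// ltW.
have p3 : 0 <= 4 * P ^+ 2 * q by rewrite !mulr_ge0 ?sqr_ge0// ltW.
have p4 : 0 <= 2 * P * (1 + B) * q by rewrite !mulr_ge0// ltW.
have p5 : 0 <= i * (en - eg) by rewrite mulr_ge0 ?subr_ge0// ltW.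
rewrite HsE in uP' lP T4.
by rewrite ler_norml; apply/andP; split; lra.
Qed.

(** * The gap identity at a fixed number of directions *)

Section GapIdentity.
Context {R : realType}.
Local Notation plane := (R * R)%type.
Local Notation area := (@area R).
Implicit Types (A K : set plane) (x : plane -> plane) (u y z : plane).

Lemma quad_supp x m :
  \sum_(k < m.*2) (supp x m k.+1 * (curv x m k / (2 * hsin m * hcos m))) =
  quad m.*2 (1 - 2 * hsin m ^+ 2) (supp x m) / (2 * hsin m * hcos m).
Proof. by rewrite /quad big_distrl; apply: eq_bigr => k _; rewrite mulrA. Qed.

Lemma sum_curv x m : is_periodic m.*2 (supp x m) ->
  \sum_(k < m.*2) curv x m k / (2 * hsin m * hcos m) =
  4 * hsin m ^+ 2 * (\sum_(k < m.*2) supp x m k) / (2 * hsin m * hcos m).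
Proof.
move=> hN; rewrite -big_distrl /=; congr (_ / _).
transitivity (2 * (1 - (1 - 2 * hsin m ^+ 2)) * \sum_(k < m.*2) supp x m k).
  exact: sum_second_diff.
by ring.
Qed.

Lemma sum_width x m : (2 <= m)%N ->
  \sum_(k < m) width x (dir m k) = \sum_(k < m.*2) supp x m k.
Proof.
move=> m2; rewrite -addnn big_split_ord /= -big_split; apply: eq_bigr => k _ /=.
by rewrite /width /supp addnC dirDm.
Qed.

Lemma contact_bounded A x : contact A x -> exists2 B : R, 0 <= B &
  forall u v, dot v v = 1 -> `|dot (x u) v| <= B.
Proof.
move=> hx; pose M := `|dot (x (1, 0)) (1, 0)| + `|dot (x (- 1, 0)) (- 1, 0)| +
  (`|dot (x (0, 1)) (0, 1)| + `|dot (x (0, - 1)) (0, - 1)|).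
exists M; first by rewrite /M !addr_ge0.
move=> u v v1; have Ax := (hx u).1.
have := (hx (1, 0)).2 _ Ax; have := (hx (- 1, 0)).2 _ Ax.
have := (hx (0, 1)).2 _ Ax; have := (hx (0, - 1)).2 _ Ax.
rewrite /M; move: (dot (x (1, 0)) _) (dot (x (- 1, 0)) _) (dot (x (0, 1)) _)
  (dot (x (0, - 1)) _) => a b c d.
rewrite /dot /= !mulr0 !add0r !addr0 !mulrN !mulr1 => h1 h2 h3 h4.
have n1 : `|(x u).1| <= `|a| + `|b|.
  have := ler_norm a; have := ler_norm b; have := normr_ge0 a; have := normr_ge0 b.
  by move=> *; rewrite ler_norml; apply/andP; split; lra.
have n2 : `|(x u).2| <= `|c| + `|d|.
  have := ler_norm c; have := ler_norm d; have := normr_ge0 c; have := normr_ge0 d.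
  by move=> *; rewrite ler_norml; apply/andP; split; lra.
have v_le1 t w : t ^+ 2 + w ^+ 2 = 1 -> `|t| <= 1 :> R.
  move=> tw; rewrite -(@ler_pXn2r _ 2) ?nnegrE// expr1n real_normK ?num_real//.
  by have := sqr_ge0 w; lra.
apply: (le_trans (ler_normD _ _)); rewrite !normrM; apply: lerD.
  by apply: (le_trans _ n1); rewrite ler_piMr// (@v_le1 _ v.2)// -v1 /dot !expr2.
by apply: (le_trans _ n2); rewrite ler_piMr// (@v_le1 _ v.1)// -v1 /dot !expr2 addrC.
Qed.

Variables (K : set plane) (x : plane -> plane) (m : nat).
Hypothesis hx : contact K x.
Hypothesis wx : forall u, dot u u = 1 -> width x u = 1.
Hypothesis m2 : (2 <= m)%N.

Let q : R := hsin m.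
Let r : R := hcos m.
Let c : R := 1 - 2 * q ^+ 2.
Let s : R := 2 * q * r.
Let h := supp x m.
Let g k := h k - 2^-1.
Let N : R := m.*2%:R.

Let q0 : 0 < q. Proof. exact: hsin_gt0. Qed.
Let r0 : 0 < r. Proof. exact: hcos_gt0. Qed.
Let r2 : r ^+ 2 = 1 - q ^+ 2.
Proof. by rewrite -(hcos2Dhsin2 (R := R) m) addrK. Qed.

Let hN : is_periodic m.*2 h. Proof. by move=> k; exact: suppD2m. Qed.
Let gN : is_periodic m.*2 g. Proof. by move=> k; rewrite /g hN. Qed.

Lemma supp_antipodal k : supp x m (k + m) = 1 - supp x m k.
Proof.
have := wx (dot_dir_dir (R := R) m k); rewrite /width /supp dirDm //.
by move=> <-; ring.
Qed.

Let gm k : g (k + m)%N = - g k.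
Proof. by rewrite /g /h supp_antipodal; field. Qed.

Let sum_g : \sum_(k < m.*2) g k = 0.
Proof.
rewrite -addnn big_split_ord /= -big_split big1// => k _ /=.
by rewrite addnC gm subrr.
Qed.

Let H := supp (symm_contact x) m.

Let HE k : H k = 2^-1 + `|g k|.
Proof.
rewrite /H /supp symm_contactE -dirDm // -!/(supp x m _) supp_antipodal.
by rewrite /g /h; case: leP => h1; [rewrite ler0_norm|rewrite gtr0_norm];
  lra.
Qed.

Variable B : R.
Hypothesis B0 : 0 <= B.
Hypothesis hB : forall u v, dot v v = 1 -> `|dot (x u) v| <= B.

Let qr1 : q <= 1 /\ r <= 1.
Proof.
have := sqr_ge0 q; have := sqr_ge0 r; move: r2 q0 r0.
by move: q r => a b; split; nra.
Qed.

Let perp_dir k : dot (perp (dir m k)) (perp (dir m k)) = 1 :> R.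
Proof. by rewrite -(dot_dir_dir m k) /dot /perp /= mulrNN addrC. Qed.

Let dirP k : dir m k = c *: dir m k.+1 - s *: perp (dir m k.+1) :> plane.
Proof.
rewrite dirS// -/q -/r -/c -/s; move: (dir m k) => v.
rewrite !pairZ /perp [LHS]surjective_pairing /c /s.
by congr pair => /=; ring: r2.
Qed.

Let g_bound k : `|g k| <= B + 2^-1.
Proof.
have := hB (dir m k) (dot_dir_dir m k); rewrite -/(supp x m k) -/(h k).
rewrite /g; move: (h k) => t; rewrite ler_norml => /andP[h1 h2].
by rewrite ler_norml; apply/andP; split; lra.
Qed.

(** The contact point of one direction, tested in the next, bounds the increment on one side;
    exchanging the two bounds it on the other. One step changes a direction by [1 - c] along itself
    and [s] along its perpendicular, both of order [q]. *)
Let g_diff k : `|g k.+1 - g k| <= 4 * q * B.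
Proof.
have [q1 r1] := qr1.
have c1 : 1 - c = 2 * q ^+ 2 by rewrite /c; ring.
have le4 : (1 - c) * B + s * B <= 4 * q * B.
  rewrite c1 -mulrDl ler_wpM2r// /s expr2.
  by have := ler_wpM2l (ltW q0) q1; have := ler_wpM2l (ltW q0) r1; lra.
have s0 : 0 <= s by rewrite !mulr_ge0// ltW.
have c0 : 0 <= 1 - c by rewrite c1 mulr_ge0// sqr_ge0.
have e1 : h k.+1 - h k <= (1 - c) * B + s * B.
  have h1 : dot (x (dir m k.+1)) (dir m k) <= h k by exact: (hx _).2 _ (hx _).1.
  rewrite (dirP k) dotDr dotNr !dotZr -/(supp x m k.+1) -/(h k.+1) in h1.
  have h2 : h k.+1 <= B by apply: le_trans (ler_norm _) (hB _ (dot_dir_dir m _)).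
  have h3 : dot (x (dir m k.+1)) (perp (dir m k.+1)) <= B.
    exact: le_trans (ler_norm _) (hB _ (perp_dir _)).
  have := ler_wpM2l c0 h2; have := ler_wpM2l s0 h3; lra.
have e2 : h k - h k.+1 <= (1 - c) * B + s * B.
  have h1 : dot (x (dir m k)) (dir m k.+1) <= h k.+1 by exact: (hx _).2 _ (hx _).1.
  rewrite dirS// -/q -/r -/c -/s dotDr !dotZr -/(supp x m k) -/(h k) in h1.
  have h2 : h k <= B by apply: le_trans (ler_norm _) (hB _ (dot_dir_dir m _)).
  have h3 : - dot (x (dir m k)) (perp (dir m k)) <= B.
    by apply: le_trans (ler_norm _) _; rewrite normrN; exact: hB.
  have := ler_wpM2l c0 h2; have := ler_wpM2l s0 h3; lra.
by rewrite /g ler_norml; apply/andP; split; lra.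
Qed.

(* The curvature radii of [K] and of its antipode are nonnegative and add up
   to a constant, so that both are bounded. *)
Let g_diff2 k : `|g k.+2 - 2 * g k.+1 + g k| <= 2 * q ^+ 2 * (2 + 2 * B).
Proof.
have := curv_ge0 hx m2 k; have := curv_ge0 hx m2 (k + m).
rewrite /curv -!addSn -!/(h _) -/q.
have hE j : h j = 2^-1 + g j by rewrite /g; ring.
rewrite !hE !gm => h1 h2.
have := g_bound k.+1; rewrite ler_norml => /andP[h3 h4].
have q20 := sqr_ge0 q.
have := ler_wpM2l q20 h3; have := ler_wpM2l q20 h4.
by move=> *; rewrite ler_norml; apply/andP; split; lra.
Qed.

(** The first conclusion holds because the support function of the hull is at least 1/2; it makes
    [hsin m] tend to 0 without any limit of the sine. *)
Lemma gap_bound (P aK aS : R) : measurable K -> convex_set K ->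
  measurable (symm_hull K) -> area K = aK%:E -> area (symm_hull K) = aS%:E ->
  2 * hsin m * (\sum_(k < m) width (symm_contact x) (dir m k)) <= P ->
  P * hcos m <= 2 * hsin m * (\sum_(k < m) width (symm_contact x) (dir m k)) ->
  hsin m <= P / m.*2%:R /\ (hsin m <= 2^-1 :> R ->
  `|2 * aK - 2 * aS + P - m.*2%:R * hsin m / hcos m| <=
  (16 * (P * (1 + B)) ^+ 2 + 8 * P * (B * (1 + B)) + 4 * P ^+ 2 +
    2 * P * (1 + B)) * hsin m).
Proof.
move=> mK cK mS eK eS.
have K0 : K !=set0 by exists (x 0); exact: (hx 0).1.
have hS := symm_hull_contact cK K0 hx.
have cS := @symm_hull_convex _ K.
have NgN : is_periodic m.*2 (fun k => `|g k|) by move=> k; rewrite gN.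
have sumH : \sum_(k < m.*2) H k = N / 2 + \sum_(k < m.*2) `|g k|.
  rewrite (eq_bigr _ (fun (k : 'I_m.*2) _ => HE k)) big_split /=.
  by rewrite sumr_const card_ord -[_ *+ _]mulr_natr mulrC.
have sumh : \sum_(k < m.*2) h k = N / 2.
  transitivity (\sum_(k < m.*2) (2^-1 + g k)).
    by apply: eq_bigr => k _; rewrite /g; ring.
  rewrite big_split /= sum_g addr0.
  by rewrite sumr_const card_ord -[_ *+ _]mulr_natr mulrC.
rewrite sum_width// -/H sumH -/q -/r -/N => lP uP.
have N0 : 0 < N by rewrite ltr0n; lia.
have G0 : 0 <= \sum_(k < m.*2) `|g k| by apply: sumr_ge0.
split.
  rewrite ler_pdivlMr//; apply: le_trans lP.
  by have := mulr_ge0 (ltW q0) G0; lra.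
move=> qh.
have GN : \sum_(k < m.*2) `|g k| <= N * (B + 2^-1).
  rewrite /N -[X in X%:R](card_ord m.*2) mulr_natl -sumr_const.
  by apply: ler_sum => k _; exact: g_bound.
have QK : quad m.*2 c h = N * q ^+ 2 + quad m.*2 c g.
  rewrite (@quad_shift _ _ c _ g gN); last by move=> k; rewrite /g; ring.
  by rewrite sum_g -/N /c; field.
have QS : quad m.*2 c H = N * q ^+ 2 + 4 * q ^+ 2 * (\sum_(k < m.*2) `|g k|) +
    quad m.*2 c (fun k => `|g k|).
  rewrite (@quad_shift _ _ c _ (fun k => `|g k|) NgN); last exact: HE.
  by rewrite -/N /c; field.
have HN : is_periodic m.*2 H by move=> k; exact: suppD2m.
have uK := area_le_supp hx m2 mK cK; have lK := area_ge_supp hx m2 mK cK.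
have uS := area_le_supp hS m2 mS cS; have lS := area_ge_supp hS m2 mS cS.
move: uK lK uS lS; rewrite eK eS !lee_fin !quad_supp !sum_curv//.
rewrite -!/q -!/r -!/c -!/h -!/H QK QS sumh sumH => uK lK uS lS.
apply: (@gap_estimate R q r N B P (\sum_(k < m.*2) `|g k|)
  (quad m.*2 c g) (quad m.*2 c (fun k => `|g k|)) aK aS q0 qh r0 r2 (ltW N0) B0 G0 GN).
- by rewrite -subr_ge0; exact: quad_norm_ge.
(* With [L = 4 q B] and [D = 2 q^2 (2 + 2 B)], the product [L / 2 * (N * D)] is exactly the required
   bound. *)
- apply: le_trans (quad_norm_le c gN g_diff g_diff2) _.
  by rewrite -/N le_eqVlt; apply/orP; left; apply/eqP; field.
- by lra.
- by lra.
- by lra.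
- by lra.
- exact: lP.
- exact: uP.
Qed.

End GapIdentity.

(** * Conclusion *)

Section Duality.
Context {R : realType}.
Local Notation area := (@area R).
Implicit Types K : set (R * R).

Lemma CW_gap K : CW K -> exists aK aS P C : R,
  [/\ area K = aK%:E, area (symm_hull K) = aS%:E,
      perimeter (symm_hull K) = P%:E, 0 <= C &
      forall m, (2 <= m)%N -> hsin m <= P / m.*2%:R /\
        (hsin m <= 2^-1 :> R ->
        `|2 * aK - 2 * aS + P - m.*2%:R * hsin m / hcos m| <= C * hsin m)].
Proof.
move=> [[cpK cK iK] cw].
have K0 : K !=set0 by case: iK => z /interior_subset Kz; exists z.
have [x hx] := compact_contact cpK K0.
have wx u : dot u u = 1 -> width x u = 1 by exact: (constant_width_contact cw iK hx).
have hS := symm_hull_contact cK K0 hx.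
have mK : measurable K by apply: closed_measurable_plane; exact: closed_compact_plane.
have mS : measurable (symm_hull K).
  apply: closed_measurable_plane; apply: closed_compact_plane.
  exact: symm_hull_compact.
(* Any circumscribed polygon shows that the area is finite; [m = 2] gives a rectangle. *)
have [aK eK _] := area_bounded_fin (area_le_supp hx (isT : (2 <= 2)%N) mK cK).
have [aS eS _] := area_bounded_fin
  (area_le_supp hS (isT : (2 <= 2)%N) mS (@symm_hull_convex _ K)).
have [P [eP hP]] := perimeter_bounds hS.
have [B B0 hB] := contact_bounded hx.
have P0 : 0 <= P.
  (* The empty polygon, of length 0, is among those in the supremum. *)
  by rewrite -lee_fin -eP; apply: ereal_sup_ubound; exists 0%N, (fun=> 0);
    split => //; [case|case|rewrite /polygon_length big_ord0].
exists aK, aS, P, (16 * (P * (1 + B)) ^+ 2 + 8 * P * (B * (1 + B)) + 4 * P ^+ 2 +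
    2 * P * (1 + B)).
split=> //; last first.
  by move=> m m2; have [lP uP] := hP m m2; exact: (gap_bound hx wx m2 B0 hB).
have B1 : 0 <= 1 + B by rewrite addr_ge0.
by rewrite !addr_ge0// !mulr_ge0// sqr_ge0.
Qed.

(** At each [m] both gaps are within a multiple of [hsin m] of the same number, so a positive
    difference is contradicted by a single large [m]. *)
Lemma CW_gap_constant K K' : CW K -> CW K' -> exists aK aS P aK' aS' P' : R,
  [/\ area K = aK%:E, area (symm_hull K) = aS%:E &
      perimeter (symm_hull K) = P%:E] /\
  [/\ area K' = aK'%:E, area (symm_hull K') = aS'%:E,
      perimeter (symm_hull K') = P'%:E &
      2 * aK - 2 * aS + P = 2 * aK' - 2 * aS' + P'].
Proof.
move=> /CW_gap[aK [aS [P [C [eK eS eP C0 h]]]]].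
move=> /CW_gap[aK' [aS' [P' [C' [eK' eS' eP' C'0 h']]]]].
exists aK, aS, P, aK', aS', P'; split => //; split => //.
set F := LHS; set F' := RHS; apply/eqP; rewrite -subr_eq0 -normr_eq0.
rewrite eq_le normr_ge0 andbT leNgt; apply/negP => pos.
set e := `|F - F'| in pos.
have [m Pm] : exists m : nat, (2 <= m)%N /\
    P / m.*2%:R <= 2^-1 /\ (C + C') * (P / m.*2%:R) < e.
  (* The three summands secure in turn [hsin m <= 1/2], [2 <= m], and a total error below [e]. *)
  pose n := Num.truncn (`|P| + 2 + (C + C') * `|P| / e).
  have nP : `|P| + 2 + (C + C') * `|P| / e < n.+1%:R by exact: truncnS_gt.
  have t0 : 0 <= (C + C') * `|P| / e.
    by rewrite divr_ge0 ?(ltW pos)// mulr_ge0 ?addr_ge0.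
  have n0 := normr_ge0 P; have nle := ler_norm P.
  have n2 : (2 <= n.+1)%N by rewrite -(@ler_nat R); lra.
  exists n.+1; split => //.
  have d0 : 0 < n.+1.*2%:R :> R by rewrite ltr0n; lia.
  have dE : n.+1.*2%:R = n.+1%:R + n.+1%:R :> R by rewrite -addnn natrD.
  split; first by rewrite ler_pdivrMr// dE; lra.
  rewrite mulrA ltr_pdivrMr// dE.
  have : (C + C') * `|P| < e * n.+1%:R.
    by rewrite [e * _]mulrC -ltr_pdivrMr//; lra.
  have : (C + C') * P <= (C + C') * `|P| by rewrite ler_wpM2l// addr_ge0.
  have : 0 <= e * n.+1%:R by rewrite mulr_ge0// ltW.
  by lra.
move: Pm => [m2 [P2 Pe]].
have [q1 hF] := h m m2; have [_ hF'] := h' m m2.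
have qh := le_trans q1 P2.
have {}hF := hF qh; have {}hF' := hF' qh.
have : e <= (C + C') * hsin m.
  rewrite /e; set T := m.*2%:R * hsin m / hcos m in hF hF'.
  have -> : F - F' = (F - T) - (F' - T) by ring.
  by apply: le_trans (ler_normB _ _) _; rewrite mulrDl lerD.
apply/negP; rewrite -ltNge; apply: le_lt_trans Pe.
by rewrite ler_wpM2l// addr_ge0.
Qed.

End Duality.

Theorem theorem6 (R : realType) (K0 : set (R * R)) (hK0 : CW K0) :
  minimizes area CW K0 <->
  maximizes objective [set symm_hull K | K in CW] (symm_hull K0).
Proof.
(* The sum of [area K] and [objective (symm_hull K)] is the same finite number for all [K] in [CW],
   so one decreases exactly when the other increases. *)
have le_iff K : CW K -> (area K0 <= area K)%E <->
    (objective (symm_hull K) <= objective (symm_hull K0))%E.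
  move=> hK; have [a [b [P [a' [b' [P' [[ea eb eP] [ea' eb' eP' e]]]]]]]] :=
    CW_gap_constant hK0 hK.
  rewrite /objective ea eb eP ea' eb' eP' -!EFinM -!EFinB !lee_fin.
  by split; lra.
split=> [[_ h]|[_ h]]; split => //.
- by exists K0.
- by move=> _ [K hK <-]; apply/le_iff => //; exact: h.
- by move=> K hK; apply/le_iff => //; apply: h; exists K.
Qed.
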